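(* Let $\mathcal{A}=\{A_1,\dots,A_n\}$ be a finite irreducible family of real $d\times d$ matrices, let $m>0$, and consider the continuous-time linear switching system $\dot{\boldsymbol{x}}(t)=A(t)\boldsymbol{x}(t)$, $A(t)\in\mathcal{A}$, $t\ge 0$, with dwell time constraint $m$. Let $\sigma(\mathcal{A})$ be its Lyapunov exponent. For every discretization step $h>0$, let $\mathcal{A}_h$ be the $h$-discretization, let $\hat\rho(\mathcal{A}_h)$ be its (Markovian) joint spectral radius, put $\sigma_h=\ln\hat\rho(\mathcal{A}_h)$, and let $\|\cdot\|=\{\|\cdot\|_j\}_{j=1}^n$ be an extremal multinorm of $\mathcal{A}_h$. Then $$\sigma_h\ \le\ \sigma(\mathcal{A})\ \le\ \sigma_h-\frac1m\ln\left(1-\frac{\|(\mathcal{A}-\sigma_h I)^2\|}{8}\,h^2\right),$$ where $$\|(\mathcal{A}-\sigma_h I)^2\|=\max_{j=1,\dots,n}\|(A_j-\sigma_h I)^2\|_j .$$ (The right-hand inequality is understood to be asserted when the argument of the logarithm is positive.)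
   Context: Switching system with dwell time $m$. The control set $\mathcal{A}=\{A_1,\dots,A_n\}$ is a finite set of real $d\times d$ matrices. A switching law is a piecewise constant function $A:[0,+\infty)\to\mathcal{A}$ all of whose stationary (switching) intervals have length at least $m$, where $m>0$ is fixed. A trajectory is a solution $\boldsymbol{x}:[0,\infty)\to\mathbb{R}^d$ of $\dot{\boldsymbol{x}}(t)=A(t)\boldsymbol{x}(t)$ for some such switching law and some initial point $\boldsymbol{x}(0)\in\mathbb{R}^d$. Lyapunov exponent. $\sigma(\mathcal{A})$ is the infimum of the numbers $\alpha$ such that every trajectory satisfies $\|\boldsymbol{x}(t)\|\le Ce^{\alpha t}$ for all $t\ge 0$, with some constant $C=C(\boldsymbol{x})$. Irreducibility. $\mathcal{A}$ is irreducible if the matrices of $\mathcal{A}$ have no common invariant linear subspace other than $\{0\}$ and $\mathbb{R}^d$. $h$-discretization $\mathcal{A}_h$. It is the following dynamical system on the complete directed graph (with loops) on $n$ vertices. To each vertex $j\in\{1,\dots,n\}$ is attached the space $V_j=\mathbb{R}^d$. To each ordered pair $(i,j)$ is attached an edge from $i$ to $j$ with a linear operator $E_{ji}:V_i\to V_j$ and a time of action $h_{ji}>0$, namely $E_{jj}=e^{hA_j}$, $h_{jj}=h$, and $E_{ji}=e^{mA_j}$, $h_{ji}=m$ for $i\ne j$. A trajectory of $\mathcal{A}_h$ is given by a sequence of vertices $i_0,i_1,i_2,\dots$ (arbitrary elements of $\{1,\dots,n\}$) and a point $\boldsymbol{x}_0\in V_{i_0}$, with $\boldsymbol{x}_{k+1}=E_{i_{k+1}i_k}\boldsymbol{x}_k\in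 V_{i_{k+1}}$; the point $\boldsymbol{x}_k$ corresponds to the time $t_k=\sum_{s=1}^k h_{i_s i_{s-1}}$. Multinorm. A multinorm is a collection of norms $\{\|\cdot\|_j\}_{j=1}^n$, with $\|\cdot\|_j$ a norm on $V_j$; one writes $\|\boldsymbol{x}\|=\|\boldsymbol{x}\|_j$ for $\boldsymbol{x}\in V_j$. For a matrix $X$, $\|X\|_j$ is the operator norm of $X$ induced by $\|\cdot\|_j$. Joint spectral radius. $\hat\rho(\mathcal{A}_h)=\lim_{k\to\infty}\max\|\boldsymbol{x}_k\|^{1/t_k}$, where the maximum is over all trajectories $\{\boldsymbol{x}_s\}_{s=0}^k$ of $\mathcal{A}_h$ with $\|\boldsymbol{x}_0\|=1$ (the limit exists and does not depend on the multinorm). Extremal multinorm. A multinorm is extremal for $\mathcal{A}_h$ if $\|E_{ji}\boldsymbol{x}\|_j\le \hat\rho(\mathcal{A}_h)^{h_{ji}}\|\boldsymbol{x}\|_i$ for all $i,j\in\{1,\dots,n\}$ and all $\boldsymbol{x}\in V_i$. $I$ is the identity matrix. *)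

(* Defs.v *)
From HB Require Import structures.
From mathcomp Require Import all_boot all_order all_algebra.
From mathcomp Require Import all_classical all_reals all_analysis.

Set Implicit Arguments.
Unset Strict Implicit.
Unset Printing Implicit Defensive.

Import Order.TTheory GRing.Theory Num.Theory.
Import numFieldNormedType.Exports.

Local Open Scope classical_set_scope.
Local Open Scope ring_scope.

(* A family of n real d x d matrices is a map A : 'I_n -> 'M[R]_d; matrices
   act on column vectors. *)

Definition expmx (R : realType) (d : nat) (X : 'M[R]_d) : 'M[R]_d :=
  limn (series (fun k : nat => (k`!%:R)^-1 *: X ^+ k)).

Definition irreducible_family (R : realType) (d n : nat)
    (A : 'I_n -> 'M[R]_d) : Prop :=
  forall U : {vspace 'cV[R]_d},
    (forall (j : 'I_n) (v : 'cV[R]_d), v \in U -> A j *m v \in U) ->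
    U = 0%VS \/ U = fullv.

(* L is the switching law and tau its sequence of switching times.  L may take
   the same value on two consecutive intervals, so a law with finitely many
   switches is covered by cutting its last, unbounded stationary interval (and
   a maximal stationary interval is a union of intervals of length >= m).
   The value of L at a switching time is any element of the family. *)
Definition switching_law (R : realType) (d n : nat) (A : 'I_n -> 'M[R]_d)
    (m : R) (tau : nat -> R) (L : R -> 'M[R]_d) : Prop :=
  [/\ tau 0%N = 0,
      forall k, tau k + m <= tau k.+1,
      forall t, 0 <= t -> exists j, L t = A j
    & forall k s t, tau k < s < tau k.+1 -> tau k < t < tau k.+1 -> L s = L t].

(* Solutions are continuous on [0, +oo[ and satisfy the equation at all
   times other than the switching times. *)
Definition trajectory (R : realType) (d n : nat) (A : 'I_n -> 'M[R]_d)
    (m : R) (x : R -> 'cV[R]_d) : Prop :=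
  exists (tau : nat -> R) (L : R -> 'M[R]_d),
    [/\ switching_law A m tau L,
        {within `[0, +oo[, continuous x}
      & forall k t, tau k < t < tau k.+1 ->
          is_derive t (1 : R) x (L t *m x t)].

(* The constant C may depend on x, so the choice of the norm `|.| on R^d is
   immaterial. *)
Definition lyapunov_exponent (R : realType) (d n : nat)
    (A : 'I_n -> 'M[R]_d) (m : R) : \bar R :=
  ereal_inf [set a%:E | a in [set a : R |
    forall x, trajectory A m x ->
      exists C : R, forall t, 0 <= t -> `|x t| <= C * expR (a * t)]].

(* As for E_{ji} and h_{ji}, the target j of the edge comes first. *)
Definition edge_time (R : realType) (n : nat) (m h : R) (j i : 'I_n) : R :=
  if j == i then h else m.

Definition edge_op (R : realType) (d n : nat) (A : 'I_n -> 'M[R]_d)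
    (m h : R) (j i : 'I_n) : 'M[R]_d :=
  expmx (edge_time m h j i *: A j).

Definition disc_trajectory (R : realType) (d n : nat) (A : 'I_n -> 'M[R]_d)
    (m h : R) (v : nat -> 'I_n) (x : nat -> 'cV[R]_d) : Prop :=
  forall k, x k.+1 = edge_op A m h (v k.+1) (v k) *m x k.

Definition disc_time (R : realType) (n : nat) (m h : R) (v : nat -> 'I_n)
    (k : nat) : R :=
  \sum_(s < k) edge_time m h (v s.+1) (v s).

(* Nonnegativity and the value 0 at 0 follow. *)
Definition is_norm (R : realType) (d : nat) (f : 'cV[R]_d -> R) : Prop :=
  [/\ forall x y, f (x + y) <= f x + f y,
      forall (a : R) x, f (a *: x) = `|a| * f x
    & forall x, f x = 0 -> x = 0].

Definition multinorm (R : realType) (d n : nat)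
    (N : 'I_n -> 'cV[R]_d -> R) : Prop :=
  forall j, is_norm (N j).

Definition op_norm (R : realType) (d : nat) (f : 'cV[R]_d -> R)
    (X : 'M[R]_d) : R :=
  sup [set f (X *m x) | x in [set x | f x <= 1]].

(* The supremum is a maximum, by compactness of unit spheres.  Only the terms
   of index s <= k of a trajectory matter at rank k, and every finite
   trajectory extends to an infinite one. *)
Definition joint_spectral_radius (R : realType) (d n : nat)
    (A : 'I_n -> 'M[R]_d) (m h : R) (N : 'I_n -> 'cV[R]_d -> R) : R :=
  limn (fun k : nat => sup [set r : R | exists v x,
    [/\ disc_trajectory A m h v x, N (v 0%N) (x 0%N) = 1
      & r = N (v k) (x k) `^ (disc_time m h v k)^-1]]).

Definition extremal_multinorm (R : realType) (d n : nat)
    (A : 'I_n -> 'M[R]_d) (m h rho : R) (N : 'I_n -> 'cV[R]_d -> R) : Prop :=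
  multinorm N /\
  forall i j x,
    N j (edge_op A m h j i *m x) <= rho `^ edge_time m h j i * N i x.

Definition shifted_square_norm (R : realType) (d n : nat)
    (A : 'I_n -> 'M[R]_d) (s : R) (N : 'I_n -> 'cV[R]_d -> R) : R :=
  \big[Num.max/0]_(j < n) op_norm (N j) ((A j - s%:M) ^+ 2).

(* Main.v *)
Require Import Defs.
From HB Require Import structures.
From mathcomp Require Import all_boot all_order all_algebra.
From mathcomp Require Import all_classical all_reals all_analysis.
From mathcomp Require Import ring lra.

Set Implicit Arguments.
Unset Strict Implicit.
Unset Printing Implicit Defensive.

Import Order.TTheory GRing.Theory Num.Theory.
Import numFieldNormedType.Exports.

Local Open Scope classical_set_scope.
Local Open Scope ring_scope.

(** The two inequalities compare the rate of growth of the continuous system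
    with that of its discretization, both measured in the multinorm [N].

    Lower bound.  A path of the discretization is, up to a finite prefix, a
    trajectory of the switching system, so it suffices to find one infinite
    path along which the norm stays above a constant times
    [exp (sigma_h * time)].  For each length some path of that length does not
    contract by the factor 1/2 relative to [rho ^ time]: otherwise, iterating
    the contraction, the quantities whose limit is [rho] would stay below a
    number smaller than [rho] ([noncontracting_path]).  One may start from a
    vector of the standard basis, and since [N] is extremal all the
    intermediate norms are large as well; the pigeonhole principle fixes the
    basis vector and Koenig's lemma yields the infinite path ([growing_path]).
    The path is then cut into blocks with a constant matrix and duration at
    least [m] ([blocks_exist]), which are the stationary intervals of a
    trajectory ([glued_trajectory]).

    Upper bound.  Put [B = A_j - sigma_h].  Along [u' = B u] one has
    [u'' = B^2 u]; if [u] has norm at most [c] at both ends of an interval of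
    length [h] and [M] is the maximum of its norm there, the estimate for the
    error of linear interpolation gives [M <= c + K M h^2 / 8], that is,
    [(1 - K h^2 / 8) M <= c] ([norm_interpolation]).  Hence each maximal
    stationary interval costs at most the factor [1 / (1 - K h^2 / 8)]: the
    first [m] units of time and each of the following steps of length [h]
    cost nothing, as [N] is extremal, and only the last, incomplete step has
    to be interpolated ([norm_stay]).  As stationary intervals have length at
    least [m], up to time [t] there are about [t / m] of them
    ([trajectory_bound]). *)

(** * Calculus of matrix-valued functions *)

Section matrix_calculus.
Variable R : realType.

Lemma mx_norm_coord (p q : nat) (X : 'M[R]_(p, q)) i j : `|X i j| <= `|X|.
Proof.
rewrite [leRHS]/Num.Def.normr/= mx_normrE.
exact: (le_bigmax _ (fun ij => `|X ij.1 ij.2|) (i, j)).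
Qed.

Lemma mx_norm_le (p q : nat) (X : 'M[R]_(p, q)) a :
  0 <= a -> (forall i j, `|X i j| <= a) -> `|X| <= a.
Proof.
by move=> a0 Xa; rewrite [leLHS]/Num.Def.normr/= mx_normrE bigmax_le.
Qed.

Lemma mulmx_norm_le (p q r : nat) (X : 'M[R]_(p, q)) (Y : 'M[R]_(q, r)) :
  `|X *m Y| <= q%:R * `|X| * `|Y|.
Proof.
apply: mx_norm_le => [|i j]; first by rewrite !mulr_ge0.
rewrite mxE; apply: (le_trans (ler_norm_sum _ _ _)).
apply: (@le_trans _ _ (\sum_(k < q) `|X| * `|Y|)).
  by apply: ler_sum => k _; rewrite normrM ler_pM ?mx_norm_coord.
by rewrite sumr_const card_ord -[leLHS]mulr_natl mulrA.
Qed.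

Lemma is_derive_mxP (p q : nat) (M : R -> 'M[R]_(p, q)) (t : R) D :
  is_derive t (1 : R) M D <->
  forall i j, is_derive t (1 : R) (fun s => M s i j) (D i j).
Proof.
split=> [dM i j|dM].
  have [dMt <-] := dM; rewrite derive_mx// mxE.
  by apply: derivableP; exact: (derivable_mxP M t 1).1.
have dMt : derivable M t 1.
  by apply/derivable_mxP => i j; have [] := dM i j.
apply: DeriveDef => //; rewrite derive_mx//; apply/matrixP => i j.
by rewrite mxE derive_val.
Qed.

Lemma is_derive_mulmx (p q r : nat) (F : R -> 'M[R]_(p, q))
    (G : R -> 'M[R]_(q, r)) (t : R) dF dG :
  is_derive t (1 : R) F dF -> is_derive t (1 : R) G dG ->
  is_derive t (1 : R) (fun s => F s *m G s) (dF *m G t + F t *m dG).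
Proof.
move=> /is_derive_mxP dFt /is_derive_mxP dGt; apply/is_derive_mxP => i j.
have -> : (fun s => (F s *m G s) i j) =
    \sum_(k < q) ((fun s => F s i k) * (fun s => G s k j)).
  by apply/funext => s; rewrite mxE fct_sumE.
apply: is_derive_eq; rewrite !mxE -big_split/=; apply: eq_bigr => k _.
by rewrite addrC; congr (_ + _); exact: mulrC.
Qed.

Lemma is_derive_continuous (V : normedModType R) (f : R -> V) (t : R) df :
  is_derive t (1 : R) f df -> {for t, continuous f}.
Proof.
by move=> [dft _]; apply/differentiable_continuous/derivable1_diffP.
Qed.

Lemma is_derive_affine (g : R -> R) (a b t : R) D :
  is_derive (a * t + b) (1 : R) g D ->
  is_derive t (1 : R) (fun s => g (a * s + b)) (a * D).
Proof.
move=> dg; have ab' : is_derive t 1 (fun s : R => a * s + b) a.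
  by apply: is_derive_eq; rewrite addr0 scaler1.
rewrite mulrC; exact: (@is_derive1_comp _ g (fun s => a * s + b)).
Qed.

Lemma is_derive_affine_comp (p q : nat) (F : R -> 'M[R]_(p, q))
    (a b t : R) D :
  is_derive (a * t + b) (1 : R) F D ->
  is_derive t (1 : R) (fun s => F (a * s + b)) (a *: D).
Proof.
move=> /is_derive_mxP dF; apply/is_derive_mxP => i j.
by rewrite mxE; exact: is_derive_affine (dF i j).
Qed.

Lemma cvg_sumr (T : Type) (F : set_system T) (FF : Filter F) n
    (f : 'I_n -> T -> R) (a : 'I_n -> R) :
  (forall i, f i x @[x --> F] --> a i) ->
  (\sum_(i < n) f i x) @[x --> F] --> \sum_(i < n) a i.
Proof.
by move=> fa; apply: cvg_big => [|i _]; [exact: add_continuous | exact: fa].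
Qed.

Lemma cvg_mulmx_coord (p q r s : nat) (P : 'M[R]_(p, q)) (Q : 'M[R]_(r, s))
    i j (S : nat -> 'M[R]_(q, r)) :
  cvgn S -> (fun k => (P *m S k *m Q) i j) @ \oo --> (P *m limn S *m Q) i j.
Proof.
move=> cS; rewrite mxE; under eq_fun do rewrite mxE.
apply: cvg_sumr => l; apply: cvgMr_tmp.
rewrite mxE; under eq_fun do rewrite mxE.
apply: cvg_sumr => e; apply: cvgMl_tmp.
move: cS => /(@cvg_comp _ _ _ _ (fun M : 'M[R]_(q, r) => M e l) _ _ _); apply.
exact: coord_continuous.
Qed.

Lemma continuous_mulmx (p q r : nat) (F : R -> 'M[R]_(p, q))
    (G : R -> 'M[R]_(q, r)) :
  continuous F -> continuous G -> continuous (fun t => F t *m G t).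
Proof.
move=> cF cG t; apply/cvgrPdist_le => e e0; near=> s.
apply: mx_norm_le => [|i j]; first exact: ltW.
rewrite [X in `|X|]mxE [X in _ + X]mxE; move: i j; near: s.
apply: filter_forall => i; apply: filter_forall => j.
suff /cvgrPdist_le/(_ e e0) :
    (F s *m G s) i j @[s --> t] --> (F t *m G t) i j by [].
have -> : (fun s => (F s *m G s) i j) = fun s => \sum_k F s i k * G s k j.
  by apply/funext => s; rewrite mxE.
have coordc (a b : nat) (X : R -> 'M[R]_(a, b)) k l :
    continuous X -> X s k l @[s --> t] --> X t k l.
  move=> cX; apply: (@cvg_comp _ _ _ X (fun M : 'M[R]_(a, b) => M k l)).
    exact: cX.
  exact: coord_continuous.
by rewrite mxE; apply: cvg_sumr => k; apply: cvgM; exact: coordc.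
Unshelve. all: by end_near. Qed.

End matrix_calculus.

(** * The matrix exponential *)

(* The completeness and the norm of matrices, joined so that absolutely
   convergent series of matrices converge. *)
HB.instance Definition _ (R : realType) (p q : nat) := Complete.on 'M[R]_(p, q).

Section matrix_exponential.
Variables (R : realType) (d : nat).
Implicit Types (X A : 'M[R]_d) (t : R).

Lemma mx_exprS_norm_le X k : `|X ^+ k| <= (d%:R * `|X|) ^+ k.
Proof.
elim: k => [|k IH].
  rewrite !expr0; apply: mx_norm_le => // i j.
  by rewrite mxE; case: (i == j); rewrite ?normr1 ?normr0.
rewrite !exprS; apply: (le_trans (mulmx_norm_le _ _)).
by rewrite ler_wpM2l// mulr_ge0.
Qed.

Lemma exprmxZ A t k : (t *: A) ^+ k = t ^+ k *: A ^+ k.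
Proof.
elim: k => [|k IH]; first by rewrite !expr0 scale1r.
by rewrite !exprS IH -!mulmxE -scalemxAl -scalemxAr scalerA.
Qed.

Lemma is_cvg_expmx X :
  cvgn (series (fun k : nat => (k`!%:R)^-1 *: X ^+ k)).
Proof.
apply: normed_cvg.
apply: (@series_le_cvg _ _ (exp_coeff (d%:R * `|X|))) => [k|k|k|].
- exact: normr_ge0.
- by rewrite /exp_coeff /= divr_ge0// exprn_ge0// mulr_ge0.
- rewrite /= normrZ ger0_norm ?invr_ge0// /exp_coeff/= [leRHS]mulrC.
  by rewrite ler_wpM2l ?invr_ge0// mx_exprS_norm_le.
- exact: is_cvg_series_exp_coeff.
Qed.

(** The coefficients of the power series in [t] of an entry of
    [P *m expmx (t *: A)].  The left factor [P] makes the family closed under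
    term-by-term derivation, which replaces [P] by [P *m A]. *)
Definition expmx_coeff P A i j : R^nat :=
  fun k => (k`!%:R)^-1 * ((P : 'M[R]_d) *m A ^+ k) i j.

Lemma cvg_expmx_coeff P A t i j :
  pseries (expmx_coeff P A i j) t @ \oo --> (P *m expmx (t *: A)) i j.
Proof.
have := @cvg_mulmx_coord _ _ _ _ _ P 1%:M i j _ (@is_cvg_expmx (t *: A)).
rewrite mulmx1; apply: cvg_trans; apply: near_eq_cvg; apply: nearW => k.
rewrite mulmx1 /pseries /series/= mulmx_sumr summxE; apply: eq_bigr => l _.
by rewrite /expmx_coeff exprmxZ -!scalemxAr !mxE; ring.
Qed.

Lemma pseries_diffs_expmx_coeff P A i j :
  pseries_diffs (expmx_coeff P A i j) = expmx_coeff (P *m A) A i j.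
Proof.
apply/funext => k; rewrite /pseries_diffs /expmx_coeff factS natrM.
rewrite invfM mulrA mulrA divff ?pnatr_eq0// mul1r.
by rewrite exprS -mulmxE mulmxA.
Qed.

Lemma is_derive_expmx A t :
  is_derive t (1 : R) (fun s => expmx (s *: A)) (A *m expmx (t *: A)).
Proof.
apply/is_derive_mxP => i j.
have coordE s B :
    (B *m expmx (s *: A)) i j = limn (pseries (expmx_coeff B A i j) s).
  by apply/esym/cvg_lim => //; exact: cvg_expmx_coeff.
rewrite (_ : (fun s => _) = fun s => limn (pseries (expmx_coeff 1%:M A i j) s)).
  have -> : (A *m expmx (t *: A)) i j =
      limn (pseries (pseries_diffs (expmx_coeff 1%:M A i j)) t).
    by rewrite pseries_diffs_expmx_coeff mul1mx coordE.
  apply: (@pseries_snd_diffs _ _ (`|t| + 1)).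
  - by apply: cvgP; exact: cvg_expmx_coeff.
  - by rewrite pseries_diffs_expmx_coeff; apply: cvgP; exact: cvg_expmx_coeff.
  - by rewrite !pseries_diffs_expmx_coeff; apply: cvgP; exact: cvg_expmx_coeff.
  - by rewrite [ltRHS]ger0_norm// ltrDl.
by apply/funext => s; rewrite -coordE mul1mx.
Qed.

Lemma expmx0 : expmx 0 = 1%:M :> 'M[R]_d.
Proof.
apply/cvg_lim => // U /nbhs_singleton U1; exists 1%N => // -[//|k] _ /=.
rewrite /series/= big_nat_recl//= expr0 invr1 scale1r big1 ?addr0//.
by move=> i _; rewrite expr0n scaler0.
Qed.

Lemma expmx_comm A t : A *m expmx (t *: A) = expmx (t *: A) *m A.
Proof.
apply/matrixP => i j; pose S := series (fun k => (k`!%:R)^-1 *: (t *: A) ^+ k).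
have := @cvg_mulmx_coord _ _ _ _ _ A 1%:M i j _ (@is_cvg_expmx (t *: A)).
have := @cvg_mulmx_coord _ _ _ _ _ 1%:M A i j _ (@is_cvg_expmx (t *: A)).
rewrite !mul1mx !mulmx1 => SA AS.
apply: (cvg_unique _ AS) => //; move: SA; apply: cvg_trans.
apply: near_eq_cvg; apply: nearW => k; rewrite mul1mx mulmx1.
rewrite /series/= mulmx_suml mulmx_sumr.
congr (fun_of_matrix _ i j); apply: eq_bigr => l _.
rewrite exprmxZ -!scalemxAr -!scalemxAl; congr (_ *: (_ *: _)).
by rewrite !mulmxE -exprS -exprSr.
Qed.

(** The function [u |-> exp ((s + t - u) A) exp (u A)] has derivative 0; compare
    its values at [0] and [t]. *)
Lemma expmxD A s t : expmx ((s + t) *: A) = expmx (s *: A) *m expmx (t *: A).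
Proof.
pose g u := expmx ((-1 * u + (s + t)) *: A) *m expmx (u *: A).
have dg u : is_derive u (1 : R) g 0.
  have d1 := is_derive_affine_comp (is_derive_expmx A (-1 * u + (s + t))).
  have d2 := is_derive_expmx A u.
  apply: is_derive_eq (is_derive_mulmx d1 d2) _.
  by rewrite mulmxA -expmx_comm -scalemxAl scaleN1r addNr.
have gE i j u v : g u i j = g v i j.
  apply: (@is_derive_0_is_cst _ (fun w => g w i j)) => w.
  by have /is_derive_mxP/(_ i j) := dg w; rewrite mxE.
apply/matrixP => i j.
have := gE i j 0 t.
by rewrite /g mulr0 add0r scale0r expmx0 mulmx1 mulN1r [- t + _]addrC addrK.
Qed.

Lemma expmxNK A t : expmx (t *: A) *m expmx (- t *: A) = 1%:M.
Proof. by rewrite -expmxD subrr scale0r expmx0. Qed.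

Lemma is_derive_expmxV A t (z : 'cV[R]_d) :
  is_derive t (1 : R) (fun s => expmx (s *: A) *m z)
    (A *m (expmx (t *: A) *m z)).
Proof.
have := is_derive_mulmx (is_derive_expmx A t) (is_derive_cst z t (1 : R)).
by rewrite mulmx0 addr0 mulmxA.
Qed.

Lemma continuous_expmxV A (z : 'cV[R]_d) :
  continuous (fun s : R => expmx (s *: A) *m z).
Proof. by move=> t; exact: is_derive_continuous (is_derive_expmxV A t z). Qed.

(** The function [u |-> exp ((a - u) A) x u] has derivative 0. *)
Lemma linear_ode_unique A (x : R -> 'cV[R]_d) (a b : R) :
  {within `[a, b], continuous x} ->
  (forall t, a < t < b -> is_derive t (1 : R) x (A *m x t)) ->
  forall t, a <= t <= b -> x t = expmx ((t - a) *: A) *m x a.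
Proof.
move=> cx dx t /andP[a_t tb].
pose E u := expmx ((-1 * u + a) *: A).
pose y u := E u *m x u.
have dE u : is_derive u (1 : R) E (-1 *: (A *m E u)).
  exact: is_derive_affine_comp (is_derive_expmx A (-1 * u + a)).
have dy u : a < u < b -> is_derive u (1 : R) y 0.
  move=> /dx dxu; apply: is_derive_eq (is_derive_mulmx (dE u) dxu) _.
  by rewrite mulmxA /E -expmx_comm -scalemxAl scaleN1r addNr.
have ya : y t = y a.
  apply/matrixP => i j; apply/eqP; rewrite -subr_eq0; apply/eqP.
  have [||c _ ->] := @MVT_segment _ (fun u => y u i j) (fun=> 0) a t a_t.
  - move=> u; rewrite in_itv/= => /andP[au ut].
    have /is_derive_mxP/(_ i j) : is_derive u (1 : R) y 0.
      by apply: dy; rewrite au (lt_le_trans ut).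
    by rewrite mxE.
  - have cyx : {within `[a, t], continuous x}.
      apply: continuous_subspaceW cx => u /=; rewrite !in_itv/= => /andP[-> ut].
      exact: le_trans tb.
    have -> : (fun u => y u i j) = (fun u => \sum_l E u i l * x u l j).
      by apply/funext => u; rewrite /y mxE.
    move=> u; apply: cvg_sumr => l; apply: cvgM.
      have cE : continuous (fun s => E s i l).
        move=> s; have /is_derive_mxP/(_ i l) dEs := dE s.
        exact: is_derive_continuous dEs.
      exact: (continuous_subspaceT cE).
    have cl : continuous (fun M : 'cV[R]_d => M l j) by exact: coord_continuous.
    exact: cvg_comp (cyx u) (cl (x u)).
  by rewrite mul0r.
have /(congr1 (mulmx (expmx ((t - a) *: A)))) := ya.
rewrite /y /E !mulN1r addNr scale0r expmx0 mul1mx.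
rewrite (_ : - t + a = - (t - a)); last by rewrite opprB addrC.
by rewrite mulmxA expmxNK mul1mx => ->.
Qed.

End matrix_exponential.

(** * Norms and multinorms *)

Section finite_dimensional_norms.
Variables (R : realType) (d : nat) (f : 'cV[R]_d -> R).
Hypothesis f_norm : is_norm f.

Lemma is_norm0 : f 0 = 0.
Proof. by have [_ fZ _] := f_norm; rewrite -(scale0r 0) fZ normr0 mul0r. Qed.

Lemma is_normN x : f (- x) = f x.
Proof. by have [_ fZ _] := f_norm; rewrite -scaleN1r fZ normrN1 mul1r. Qed.

Lemma is_norm_ge0 x : 0 <= f x.
Proof.
have [fD _ _] := f_norm; have := fD x (- x).
by rewrite subrr is_norm0 is_normN -mulr2n pmulrn_lge0.
Qed.

Lemma is_norm_gt0 x : x != 0 -> 0 < f x.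
Proof.
move=> x0; rewrite lt_neqAle is_norm_ge0 andbT eq_sym.
by apply: contra_neq x0; have [_ _] := f_norm; exact.
Qed.

Lemma is_norm_sum (I : finType) (x : I -> 'cV[R]_d) :
  f (\sum_i x i) <= \sum_i f (x i).
Proof.
have [fD _ _] := f_norm.
elim/big_ind2 : _ => //; first by rewrite is_norm0.
by move=> a b c e ab ce; apply: le_trans (fD _ _) _; exact: lerD.
Qed.

Lemma is_norm_dist x y : `|f x - f y| <= f (x - y).
Proof.
have [fD _ _] := f_norm.
have fB a b : f a - f b <= f (a - b).
  by rewrite lerBlDr; have := fD (a - b) b; rewrite subrK.
by rewrite ler_norml fB andbT lerNl opprB -(is_normN (x - y)) opprB fB.
Qed.

Lemma is_norm_le_mx_norm : exists2 C, 0 < C & forall x, f x <= C * `|x|.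
Proof.
have [fD fZ _] := f_norm.
exists (1 + \sum_(i < d) f (delta_mx i 0)) => [|x].
  by rewrite ltr_wpDr// sumr_ge0// => i _; exact: is_norm_ge0.
rewrite {1}(matrix_sum_delta x); apply: le_trans (is_norm_sum _) _.
rewrite mulrDl mul1r mulr_suml ler_wpDl//; apply: ler_sum => i _.
by rewrite big_ord1 fZ mulrC ler_wpM2l ?is_norm_ge0// mx_norm_coord.
Qed.

Lemma is_norm_continuous : continuous f.
Proof.
have [C C0 fC] := is_norm_le_mx_norm.
move=> x; apply/(@cvgrPdist_lt _ _ _ (nbhs x) (nbhs_filter x)) => e e0.
have eC : 0 < e / C by rewrite divr_gt0.
near=> y; apply: le_lt_trans (is_norm_dist _ _) _; apply: le_lt_trans (fC _) _.
rewrite mulrC -ltr_pdivlMr//; near: y.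
Unshelve. all: by end_near. Qed.

Lemma mx_norm_trmx (p q : nat) (X : 'M[R]_(p, q)) : `|X^T| = `|X|.
Proof.
have le_trmx a b (Y : 'M[R]_(a, b)) : `|Y^T| <= `|Y|.
  by apply: mx_norm_le => // i j; rewrite mxE; exact: mx_norm_coord.
apply/eqP; rewrite eq_le; apply/andP; split; first exact: le_trmx.
by rewrite -[in leLHS](trmxK X); exact: le_trmx.
Qed.

(** The continuous function [f] has a positive minimum on the unit sphere of
    the sup norm, which is compact. *)
Lemma mx_norm_le_is_norm : exists2 c, 0 < c & forall x, `|x| <= c * f x.
Proof.
have [_ fZ _] := f_norm.
have [d0|d_gt0] := posnP d.
  exists 1 => // x; rewrite mul1r (le_trans _ (is_norm_ge0 x))//.
  by apply: mx_norm_le => // i; have := ltn_ord i; rewrite {2}d0.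
pose S := [set v : 'rV[R]_d | `|v| = 1].
have cS : compact S.
  apply: bounded_closed_compact.
    by exists 1; split=> // r r1 v /= ->; exact: ltW.
  have -> : S = (fun v : 'rV[R]_d => `|v|) @^-1` [set 1] by [].
  by apply: closed_comp => [v _|]; [exact: norm_continuous|exact: closed_eq].
pose u : 'rV[R]_d := const_mx 1.
have Su : S u.
  rewrite /S/=; apply/eqP; rewrite eq_le; apply/andP; split.
    by apply: mx_norm_le => // i j; rewrite mxE normr1.
  by have := mx_norm_coord u 0 (Ordinal d_gt0); rewrite mxE normr1.
have trc : continuous (fun v : 'rV[R]_d => v^T).
  move=> v; apply/(@cvgrPdist_lt _ _ _ (nbhs v) (nbhs_filter v)) => e e0.
  near=> w.
  rewrite -linearB/= mx_norm_trmx; near: w.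
  exact: (nbhs_ball_norm v (PosNum e0)).
have [||v Sv fv] := @EVT_min_rV _ _ (fun v : 'rV[R]_d => f v^T) S _ cS.
- by exists u.
- apply: continuous_subspaceT => v.
  by apply: continuous_comp; [exact: trc|exact: is_norm_continuous].
have fv0 : 0 < f v^T.
  apply: is_norm_gt0; apply/eqP => /(congr1 trmx); rewrite trmxK trmx0 => v0.
  by move: Sv; rewrite inE /S/= v0 normr0 => /esym/eqP; rewrite oner_eq0.
exists (f v^T)^-1 => [|x]; first by rewrite invr_gt0.
have [->|x0] := eqVneq x 0; first by rewrite normr0 is_norm0 mulr0.
rewrite mulrC ler_pdivlMr//.
have nx0 : 0 < `|x| by rewrite normr_gt0.
have := fv ((`|x|^-1 *: x)^T); rewrite inE /S/= mx_norm_trmx normrZ normfV.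
rewrite normr_id mulVf ?gt_eqF// trmxK fZ normfV normr_id => /(_ erefl).
by rewrite mulrC ler_pdivlMr// mulrC.
Unshelve. all: by end_near. Qed.

Lemma le_op_norm (X : 'M[R]_d) x : f (X *m x) <= op_norm f X * f x.
Proof.
have [_ fZ _] := f_norm.
have [C C0 fC] := is_norm_le_mx_norm; have [c c0 cf] := mx_norm_le_is_norm.
have [->|x0] := eqVneq x 0; first by rewrite mulmx0 is_norm0 mulr0.
have fx0 := is_norm_gt0 x0.
have fx1 : f ((f x)^-1 *: x) = 1.
  by rewrite fZ normfV gtr0_norm// mulVf// gt_eqF.
have ub : has_ubound [set f (X *m y) | y in [set y | f y <= 1]].
  exists (C * (d%:R * `|X| * c)) => _ [y /= fy <-].
  apply: le_trans (fC _) _; rewrite ler_wpM2l ?(ltW C0)//.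
  apply: le_trans (mulmx_norm_le _ _) _; rewrite ler_wpM2l ?mulr_ge0//.
  by apply: le_trans (cf _) _; rewrite ler_piMr// ltW.
rewrite -ler_pdivrMr//; apply: (ub_le_sup ub).
exists ((f x)^-1 *: x); first by rewrite /= fx1.
by rewrite -scalemxAr fZ normfV (gtr0_norm fx0) mulrC.
Qed.

End finite_dimensional_norms.

Lemma finite_uniform_constant (R : realType) (I : finType)
    (P : I -> R -> Prop) :
  (forall i a b, a <= b -> P i a -> P i b) ->
  (forall i, exists2 a, 0 <= a & P i a) ->
  exists2 a, 0 <= a & forall i, P i a.
Proof.
move=> Pmono Pex.
have /choice[a aP] : forall i, exists a, 0 <= a /\ P i a.
  by move=> i; have [a a0 Pa] := Pex i; exists a.
exists (\sum_i a i) => [|i]; first by rewrite sumr_ge0// => i _; case: (aP i).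
have [ai0 Pai] := aP i; apply: Pmono Pai.
by rewrite (bigD1 i)//= lerDl sumr_ge0// => j _; case: (aP j).
Qed.

Section multinorms.
Variables (R : realType) (d n : nat).
Implicit Types N : 'I_n -> 'cV[R]_d -> R.

Lemma multinorm_le_mx_norm N : multinorm N ->
  exists2 C, 0 <= C & forall j, forall x, N j x <= C * `|x|.
Proof.
move=> N_norm; apply: finite_uniform_constant => [j a b ab H x|j].
  by apply: le_trans (H x) _; rewrite ler_wpM2r.
have [C C0 CP] := is_norm_le_mx_norm (N_norm j).
by exists C => //; exact: ltW.
Qed.

Lemma mx_norm_le_multinorm N : multinorm N ->
  exists2 c, 0 <= c & forall j, forall x, `|x| <= c * N j x.
Proof.
move=> N_norm; apply: finite_uniform_constant => [j a b ab H x|j].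
  by apply: le_trans (H x) _; rewrite ler_wpM2r// is_norm_ge0.
have [c c0 cP] := mx_norm_le_is_norm (N_norm j).
by exists c => //; exact: ltW.
Qed.

Lemma multinorm_equivalent N1 N2 : multinorm N1 -> multinorm N2 ->
  exists2 C, 0 <= C & forall i j x, N1 i x <= C * N2 j x.
Proof.
move=> /multinorm_le_mx_norm[C C0 CP] /mx_norm_le_multinorm[c c0 cP].
exists (C * c) => [|i j x]; first exact: mulr_ge0.
by apply: le_trans (CP i x) _; rewrite -mulrA ler_wpM2l.
Qed.

End multinorms.

(** * Norms between two times of a linear flow *)

Section interpolation.
Variable R : realType.

Lemma is_derive_remainder (G : R -> R) (c D e : R) :
  is_derive c (1 : R) G D -> 0 < e ->
  exists2 r, 0 < r &
    forall s, `|s| < r -> `|G (c + s) - G c - s * D| <= e * `|s|.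
Proof.
move=> [dG <-] e0.
have := dG; rewrite /derivable => /cvgrPdist_le/(_ e e0)[r /= r0 rG].
exists r => // s sr.
have [->|s0] := eqVneq s 0.
  by rewrite addr0 subrr mul0r subrr normr0 mulr0.
have := rG s; rewrite /ball_/= sub0r normrN => /(_ sr s0).
rewrite -/('D_1 G c) [_%:A]mulr1 => GD.
have -> : G (c + s) - G c - s * 'D_1 G c =
    - (s * ('D_1 G c - s^-1 *: (G (s + c) - G c))).
  rewrite mulrBr [s^-1 *: _]/(s^-1 * _) mulrA divff// mul1r [s + c]addrC; ring.
by rewrite normrN normrM mulrC ler_wpM2r.
Qed.

(** The mean value theorem is applied to
    [s |-> g (c + s) + g (c - s) - 2 g c - s^2 D], whose derivative
    [G (c + s) - G (c - s) - 2 s D] is [o(s)]. *)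
Lemma second_difference (g G : R -> R) (c D e : R) :
  (forall t, is_derive t (1 : R) g (G t)) -> is_derive c (1 : R) G D -> 0 < e ->
  \forall s \near 0^'+,
    `|g (c + s) + g (c - s) - 2 * g c - s ^+ 2 * D| <= e * s ^+ 2.
Proof.
move=> dg dG e0.
have [r r0 rG] := is_derive_remainder dG (divr_gt0 e0 (ltr0n _ 2)).
near=> s.
have s0 : 0 < s by [].
have sr : s < r by near: s; exact: nbhs_right_lt.
pose q x := g (1 * x + c) + g (-1 * x + c) - 2 * g c - x ^+ 2 * D.
pose dq x := G (c + x) - G (c - x) - 2 * x * D.
have dqE x : is_derive x (1 : R) q (dq x).
  have d1 := is_derive_affine (dg (1 * x + c)).
  have d2 := is_derive_affine (dg (-1 * x + c)).
  rewrite /q; apply: is_derive_eq.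
  rewrite /dq !mul1r !mulN1r [c + x]addrC [c - x]addrC.
  rewrite scaler0 add0r subr0 -[D *: _]/(D * (x * 1 + x * 1)) mulr1; ring.
have [|x] := @MVT _ q dq 0 s s0 (fun x _ => dqE x).
  by apply: continuous_subspaceT => x; exact: is_derive_continuous (dqE x).
rewrite in_itv/= => /andP[x0 xs].
have -> : q s = g (c + s) + g (c - s) - 2 * g c - s ^+ 2 * D.
  by rewrite /q mul1r mulN1r [c + s]addrC [c - s]addrC.
have -> : q 0 = 0 by rewrite /q !mulr0 !add0r; ring.
rewrite !subr0 => ->; rewrite normrM (gtr0_norm s0).
have xr : `|x| < r by rewrite gtr0_norm// (lt_trans xs).
have := rG (- x); rewrite normrN => /(_ xr) h1; have h2 := rG x xr.
rewrite expr2 mulrA ler_wpM2r ?(ltW s0)//.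
have -> : dq x = (G (c + x) - G c - x * D) - (G (c - x) - G c - - x * D).
  by rewrite /dq; ring.
apply: le_trans (ler_normB _ _) _; apply: le_trans (lerD h2 h1) _.
rewrite gtr0_norm//; nra.
Unshelve. all: by end_near. Qed.

Lemma second_difference_linear_ode (d : nat) (B : 'M[R]_d) (u : R -> 'cV[R]_d)
    (c e : R) :
  (forall t, is_derive t (1 : R) u (B *m u t)) -> 0 < e ->
  \forall s \near 0^'+,
    `|u (c + s) + u (c - s) - 2 *: u c - s ^+ 2 *: (B *m (B *m u c))|
      <= e * s ^+ 2.
Proof.
move=> du e0; near=> s; apply: mx_norm_le => [|i j].
  by rewrite mulr_ge0 ?sqr_ge0// ltW.
rewrite !mxE; move: i j; near: s.
apply: filter_forall => i; apply: filter_forall => j.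
have := @second_difference (fun t => u t i j) (fun t => (B *m u t) i j) c
  ((B *m (B *m u c)) i j) e.
rewrite [(B *m (B *m _)) i j]mxE; apply=> // [t|].
  by have /is_derive_mxP/(_ i j) := du t.
have := is_derive_mulmx (is_derive_cst B c (1 : R)) (du c).
by rewrite mul0mx add0r => /is_derive_mxP/(_ i j); rewrite mxE.
Unshelve. all: by end_near. Qed.

(** With [M] the maximum of [f \o u] on the interval, [psi t = f (u t) +
    (K M + e') / 2 * t (t - h)] has no interior maximum: at such a point its
    second difference with step [s] would be at most 0, whereas that of
    [f \o u] is at least [- s^2 f (B^2 u) + o(s^2) >= - s^2 K M + o(s^2)] and
    that of the quadratic term is [(K M + e') s^2].  Hence [psi <= c], and
    [t (h - t) <= h^2 / 4] bounds [M].  This replaces the usual proof, which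
    applies a norming functional to [u]. *)
Lemma norm_interpolation (d : nat) (f : 'cV[R]_d -> R) (B : 'M[R]_d)
    (u : R -> 'cV[R]_d) (h K c : R) :
  is_norm f -> 0 < h -> 0 <= K -> 0 < 1 - K / 8 * h ^+ 2 ->
  (forall x, f (B *m (B *m x)) <= K * f x) ->
  (forall t, is_derive t (1 : R) u (B *m u t)) ->
  f (u 0) <= c -> f (u h) <= c ->
  forall t, 0 <= t <= h -> (1 - K / 8 * h ^+ 2) * f (u t) <= c.
Proof.
move=> fN h0 K0 Kh fB du f0 fh.
have [fD fZ _] := fN.
have cf : continuous (f \o u).
  move=> t; apply: continuous_comp; first exact: is_derive_continuous (du t).
  exact: is_norm_continuous.
have [s0 sI fM] := EVT_max (ltW h0) (continuous_subspaceT cf).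
pose M := f (u s0).
have M0 : 0 <= M by exact: is_norm_ge0.
suff Mle : M <= c + K * M * h ^+ 2 / 8.
  move=> t t0h; apply: (@le_trans _ _ ((1 - K / 8 * h ^+ 2) * M)).
    rewrite ler_wpM2l ?(ltW Kh)//; apply: fM; rewrite in_itv/=; exact: t0h.
  rewrite -subr_ge0; move: Mle; rewrite -subr_ge0; congr (_ <= _); ring.
apply/ler_addgt0Pr => e e0.
(* Chosen so that [e' * h^2 / 8 = e]. *)
pose e' := 8 * e / h ^+ 2.
have h20 : 0 < h ^+ 2 by rewrite exprn_gt0.
have e'0 : 0 < e' by rewrite /e' divr_gt0// mulr_gt0.
pose psi t := f (u t) + (K * M + e') / 2 * (t * (t - h)).
have cpsi : continuous psi.
  move=> t; apply: cvgD; first exact: cf.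
  by apply: cvgMl_tmp; apply: cvgM => //; apply: cvgB => //; exact: cvg_cst.
have [s1 s1I psiM] := EVT_max (ltW h0) (continuous_subspaceT cpsi).
suff psi1 : psi s1 <= c.
  have := le_trans (psiM _ sI) psi1.
  have KM : 0 <= K * M by rewrite mulr_ge0.
  have -> : e = e' * h ^+ 2 / 8 by rewrite /e'; field; rewrite gt_eqF.
  rewrite /psi -/M; have := sqr_ge0 (s0 - h / 2); nra.
move: s1I psiM; rewrite in_itv/= => /andP[].
rewrite le_eqVlt => /orP[/eqP <- _ _|s10].
  by rewrite /psi mul0r mulr0 addr0.
rewrite le_eqVlt => /orP[/eqP -> _|s1h psiM].
  by rewrite /psi subrr !mulr0 addr0.
exfalso.
(* The error term of the second difference, measured by [f], is at most
   [e' / 2 * s^2]. *)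
have [C C0 fC] := is_norm_le_mx_norm fN.
have eC0 : 0 < e' / (2 * C) by rewrite divr_gt0// mulr_gt0.
near (at_right (0 : R)) => s.
have s_gt0 : 0 < s by [].
have ss1 : s < s1 by near: s; exact: nbhs_right_lt.
have sh : s < h - s1 by near: s; apply: nbhs_right_lt; rewrite subr_gt0.
pose w := u (s1 + s) + u (s1 - s) - 2 *: u s1 - s ^+ 2 *: (B *m (B *m u s1)).
have fw : f w <= e' / 2 * s ^+ 2.
  have -> : e' / 2 = C * (e' / (2 * C)) by field; rewrite gt_eqF.
  apply: le_trans (fC _) _; rewrite -mulrA ler_wpM2l ?(ltW C0)//.
  by rewrite /w; near: s; exact: second_difference_linear_ode.
have psi_p : psi (s1 + s) <= psi s1.
  by apply: psiM; rewrite in_itv/=; apply/andP; split; lra.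
have psi_m : psi (s1 - s) <= psi s1.
  by apply: psiM; rewrite in_itv/=; apply/andP; split; lra.
have fBu : f (B *m (B *m u s1)) <= K * M.
  apply: le_trans (fB _) _; rewrite ler_wpM2l//; apply: fM.
  by rewrite in_itv/= !ltW.
have f2 : 2 * f (u s1) <=
    f (u (s1 + s)) + f (u (s1 - s)) + f w + s ^+ 2 * f (B *m (B *m u s1)).
  have -> : 2 * f (u s1) = f (2 *: u s1) by rewrite fZ gtr0_norm.
  have -> : 2 *: u s1 =
      u (s1 + s) + u (s1 - s) + - w + - (s ^+ 2 *: (B *m (B *m u s1))).
    by apply/matrixP => i j; rewrite /w !mxE; ring.
  rewrite -(is_normN fN w).
  have -> : s ^+ 2 * f (B *m (B *m u s1)) =
      f (- (s ^+ 2 *: (B *m (B *m u s1)))).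
    by rewrite is_normN// fZ ger0_norm// sqr_ge0.
  do 2 (apply: le_trans (fD _ _) _; rewrite lerD2r).
  exact: fD.
have s20 : 0 < s ^+ 2 by rewrite exprn_gt0.
have es : 0 < e' * s ^+ 2 by rewrite mulr_gt0.
have : s ^+ 2 * f (B *m (B *m u s1)) <= s ^+ 2 * (K * M).
  by rewrite ler_wpM2l// ltW.
move: psi_p psi_m f2 fw; rewrite /psi => p1 p2 p3 p4 p5.
nra.
Unshelve. all: by end_near. Qed.

End interpolation.

(** * Growth of the trajectories of the switching system *)

Section upper_bound.
Variables (R : realType) (d n : nat) (A : 'I_n -> 'M[R]_d) (m h s K : R).
Variable N : 'I_n -> 'cV[R]_d -> R.
Hypotheses (m_gt0 : 0 < m) (h_gt0 : 0 < h) (K_ge0 : 0 <= K).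
Hypothesis N_norm : multinorm N.
Hypothesis N_loop : forall j x,
  N j (expmx (h *: A j) *m x) <= expR (h * s) * N j x.
Hypothesis N_switch : forall i j x, i != j ->
  N j (expmx (m *: A j) *m x) <= expR (m * s) * N i x.
Hypothesis N_square : forall j x,
  N j ((A j - s%:M) ^+ 2 *m x) <= K * N j x.
Hypothesis K_small : 0 < 1 - K / 8 * h ^+ 2.

Let D := 1 - K / 8 * h ^+ 2.

Lemma norm_loop_iter j k x :
  N j (expmx ((k%:R * h) *: A j) *m x) <= expR (k%:R * h * s) * N j x.
Proof.
elim: k => [|k IH].
  by rewrite !mul0r scale0r expmx0 mul1mx expR0 mul1r.
have -> : k.+1%:R * h = h + k%:R * h by rewrite -natr1; ring.
rewrite expmxD -mulmxA mulrDl expRD -mulrA.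
by apply: le_trans (N_loop _ _) _; rewrite ler_wpM2l ?expR_ge0.
Qed.

Lemma is_derive_shifted_flow j (x : 'cV[R]_d) (t : R) :
  is_derive t (1 : R) (fun r => expR (- s * r) *: (expmx (r *: A j) *m x))
    ((A j - s%:M) *m (expR (- s * t) *: (expmx (t *: A j) *m x))).
Proof.
apply/is_derive_mxP => i k.
have /is_derive_mxP/(_ i k) dE := is_derive_expmxV (A j) t x.
have de := @is_derive_affine _ expR (- s) 0 t _ (is_derive_expR _).
have -> : (fun r => (expR (- s * r) *: (expmx (r *: A j) *m x)) i k) =
    (fun r => expR (- s * r + 0)) * (fun r => (expmx (r *: A j) *m x) i k).
  by apply/funext => r; rewrite mxE fctE addr0.
apply: is_derive_eq.
rewrite mulmxBl -!scalemxAr mul_scalar_mx !mxE !addr0.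
rewrite -[X in X + _ = _]/(_ * _) -[X in _ + X = _]/(_ * _); ring.
Qed.

(** After the complete steps of length [h] in [t] the normalized norm has not
    increased; the remaining time is an incomplete step, between whose ends
    the norm is interpolated. *)
Lemma norm_stay j (t : R) x : 0 <= t ->
  N j (expmx (t *: A j) *m x) <= D^-1 * expR (t * s) * N j x.
Proof.
move=> t0; have [fD fZ _] := N_norm j.
pose k := Num.truncn (t / h); pose r := t - k%:R * h.
have /andP[kt tk] : k%:R <= t / h < k.+1%:R.
  by rewrite truncn_itv// divr_ge0// ltW.
have r0h : 0 <= r <= h.
  rewrite /r subr_ge0 -ler_pdivlMr// kt/= lerBlDl.
  by move: tk; rewrite -natr1 ltr_pdivrMr// mulrDl mul1r => /ltW.
pose y := expmx ((k%:R * h) *: A j) *m x.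
have yr : expmx (t *: A j) *m x = expmx (r *: A j) *m y.
  by rewrite /y mulmxA -expmxD /r subrK.
pose u (q : R) := expR (- s * q) *: (expmx (q *: A j) *m y).
have NB z : N j ((A j - s%:M) *m ((A j - s%:M) *m z)) <= K * N j z.
  by rewrite mulmxA mulmxE -expr2; exact: N_square.
have := @norm_interpolation _ _ (N j) (A j - s%:M) u h K (N j y) (N_norm j)
  h_gt0 K_ge0 K_small NB (is_derive_shifted_flow j y) _ _ r r0h.
rewrite /u mulr0 expR0 scale0r expmx0 mul1mx scale1r !fZ.
rewrite !ger0_norm ?expR_ge0// lexx => /(_ isT) ur.
have {}ur : D * (expR (- s * r) * N j (expmx (r *: A j) *m y)) <= N j y.
  apply: ur; rewrite -(ler_pM2l (expR_gt0 (s * h))) mulrA -expRD.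
  by rewrite mulNr subrr expR0 mul1r [s * h]mulrC; exact: N_loop.
rewrite yr -mulrA.
rewrite -ler_pdivrMl ?invr_gt0// invrK.
rewrite -(ler_pM2l (expR_gt0 (- s * r))).
apply: le_trans (le_trans _ ur) _; first by rewrite mulrCA.
apply: le_trans (norm_loop_iter _ _ _) _.
rewrite mulrA -expRD ler_wpM2r ?is_norm_ge0//.
by rewrite ler_expR /r; nra.
Qed.

(** The factor [1 / D] lost at each switch is the growth at rate [la] during
    the time [m]. *)
Let la := - m^-1 * ln D.

Let la_ge0 : 0 <= la.
Proof.
rewrite /la mulNr oppr_ge0 mulr_ge0_le0 ?invr_ge0 ?(ltW m_gt0)// ln_le0//.
by rewrite /D lerBlDr lerDl mulr_ge0 ?sqr_ge0// divr_ge0.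
Qed.

Let expR_la : expR (m * la) = D^-1.
Proof.
rewrite /la mulrA mulrN divff ?gt_eqF// mulN1r -lnV ?posrE//.
by rewrite lnK// posrE invr_gt0.
Qed.

Lemma short_flow_bound : exists2 G, 0 <= G & forall i j (t : R) y,
  0 <= t <= m -> N j (expmx (t *: A j) *m y) <= G * N i y.
Proof.
suff [G G0 GP] : exists2 G, 0 <= G & forall ij : 'I_n * 'I_n, forall (t : R) y,
    0 <= t <= m -> N ij.2 (expmx (t *: A ij.2) *m y) <= G * N ij.1 y.
  by exists G => // i j; exact: (GP (i, j)).
apply: (@finite_uniform_constant _ _ (fun ij G => forall (t : R) y,
    0 <= t <= m -> N ij.2 (expmx (t *: A ij.2) *m y) <= G * N ij.1 y)).
  move=> ij a b ab H t y /H/le_trans; apply.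
  by rewrite ler_wpM2r// is_norm_ge0.
move=> [i j]/=.
have [C C0 CP] := is_norm_le_mx_norm (N_norm j).
have [c c0 cP] := mx_norm_le_is_norm (N_norm i).
have cE : continuous (fun t : R => `|expmx (t *: A j)|).
  move=> t; apply: continuous_comp; last exact: norm_continuous.
  exact: is_derive_continuous (is_derive_expmx (A j) t).
have [t0 _ EM] := EVT_max (ltW m_gt0) (continuous_subspaceT cE).
exists (C * (d%:R * `|expmx (t0 *: A j)| * c)).
  by rewrite !mulr_ge0// ltW.
move=> t y tm; apply: le_trans (CP _) _.
rewrite -[leRHS]mulrA ler_wpM2l ?(ltW C0)//.
apply: le_trans (mulmx_norm_le _ _) _.
rewrite -[leRHS]mulrA; apply: ler_pM => //; rewrite ?mulr_ge0//.
by rewrite ler_wpM2l//; apply: EM; rewrite in_itv.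
Qed.

(** A run of the mode [j] starts at time [r] from the point [z].  The bound
    assumed after the dwell time [m] leaves out the growth [expR (m * la)] of
    that time, which pays for the factor [1 / D] of [norm_stay]. *)
Lemma run_bound j (r t C : R) z : 0 <= C -> r + m <= t ->
  N j (expmx (m *: A j) *m z) <= C * expR (s * (r + m) + la * r) ->
  N j (expmx ((t - r) *: A j) *m z) <= C * expR ((s + la) * t).
Proof.
move=> C0 rmt Nz.
rewrite (_ : t - r = (t - (r + m)) + m); last by ring.
rewrite expmxD -mulmxA; apply: le_trans (norm_stay _ _ _) _.
  by rewrite subr_ge0.
apply: le_trans (ler_wpM2l _ Nz) _.
  by rewrite mulr_ge0 ?expR_ge0// invr_ge0 ltW.
rewrite mulrCA -expR_la -!expRD ler_wpM2l// ler_expR.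
rewrite -subr_ge0 (_ : _ - _ = la * (t - (r + m))); last by ring.
by rewrite mulr_ge0// subr_ge0.
Qed.

(** The multinorm does not control the first [m] units of time of a run, but
    they cost only a constant factor, which does not accumulate. *)
Lemma run_start_bound i j (r t C G : R) z : 0 <= C -> 0 <= G ->
  (forall y u, 0 <= u <= m -> N j (expmx (u *: A j) *m y) <= G * N i y) ->
  r <= t <= r + m -> N i z <= C * expR ((s + la) * r) ->
  N j (expmx ((t - r) *: A j) *m z) <=
    G * expR (`|s| * m) * C * expR ((s + la) * t).
Proof.
move=> C0 G0 GP /andP[rt trm] Nz.
apply: le_trans (GP _ _ _) _; first by rewrite subr_ge0 rt lerBlDl.
rewrite -!mulrA ler_wpM2l//; apply: le_trans Nz _.
rewrite mulrCA ler_wpM2l// -expRD ler_expR.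
have la' : 0 <= la * (t - r) by rewrite mulr_ge0// subr_ge0.
have : `|s| * (t - r) <= `|s| * m by rewrite ler_wpM2l// lerBlDl.
have : - `|s| * (t - r) <= s * (t - r).
  rewrite ler_wpM2r ?subr_ge0//.
  by have := ler_norm (- s); rewrite normrN => ?; lra.
rewrite !mulrDl; nra.
Qed.

(** Consecutive intervals of the law may carry the same matrix, and the
    multinorm controls [exp (m A_j)] only just after a switch.  The induction
    on the intervals therefore keeps track of the start [r] of the current run,
    that is, of the maximal stationary interval. *)
Lemma trajectory_bound x : trajectory A m x ->
  exists C : R, forall t, 0 <= t -> `|x t| <= C * expR ((s + la) * t).
Proof.
move=> [tau [L [[tau0 tauS LA Lcst] cx dx]]].
have tau_ge0 k : 0 <= tau k.
  elim: k => [|k IH]; first by rewrite tau0.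
  by apply: le_trans (tauS k); rewrite addr_ge0// ltW.
have tau_lt k : tau k < tau k.+1 by apply: lt_le_trans (tauS k); rewrite ltrDl.
have /choice[w wP] : forall k, exists j, L ((tau k + tau k.+1) / 2) = A j.
  by move=> k; apply: LA; rewrite divr_ge0// addr_ge0.
have x_flow k t : tau k <= t <= tau k.+1 ->
    x t = expmx ((t - tau k) *: A (w k)) *m x (tau k).
  apply: linear_ode_unique => [|{}t tk].
    apply: continuous_subspaceW cx => u /=.
    rewrite !in_itv/= andbT => /andP[+ _].
    exact: le_trans.
  have -> : A (w k) = L t.
    rewrite -wP; apply: (Lcst k) => //.
    by have := tau_lt k => ?; apply/andP; split; lra.
  exact: dx tk.
have [G G0 GP] := short_flow_bound.
have [c c0 cP] := mx_norm_le_multinorm N_norm.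
(* Both bounds required at the start of the first run hold with [r = 0]. *)
pose C := N (w 0%N) (x 0) +
  expR (- (s * m)) * N (w 0%N) (expmx (m *: A (w 0%N)) *m x 0).
have C0 : 0 <= C by rewrite addr_ge0 ?mulr_ge0 ?expR_ge0 ?is_norm_ge0.
pose run k r i := [/\ 0 <= r <= tau k, N i (x r) <= C * expR ((s + la) * r),
  N (w k) (expmx (m *: A (w k)) *m x r) <= C * expR (s * (r + m) + la * r) &
  forall t, r <= t <= tau k.+1 -> x t = expmx ((t - r) *: A (w k)) *m x r].
have runP k : exists r i, run k r i.
  elim: k => [|k [r [i [/andP[r0 rk] Nr Nrm xr]]]].
    exists 0, (w 0%N); split.
    - by rewrite tau0 lexx.
    - by rewrite mulr0 expR0 mulr1 /C lerDl mulr_ge0 ?expR_ge0 ?is_norm_ge0.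
    - rewrite add0r mulr0 addr0 /C mulrDl [expR _ * _]mulrC -mulrA -expRD.
      by rewrite addNr expR0 mulr1 lerDr mulr_ge0 ?expR_ge0 ?is_norm_ge0.
    - by move=> t tt; rewrite -tau0; apply: x_flow; rewrite tau0.
  have rk1 : r + m <= tau k.+1 by apply: le_trans (tauS k); rewrite lerD2r.
  have [wk|wk] := eqVneq (w k) (w k.+1).
    exists r, i; split => //; rewrite -?wk//.
      by rewrite r0 (le_trans rk)// ltW.
    move=> t /andP[rt tk2]; have [tk1|tk1] := leP t (tau k.+1).
      by apply: xr; rewrite rt.
    rewrite (x_flow k.+1) ?(ltW tk1)// xr ?lexx ?andbT; last first.
      by rewrite (le_trans _ rk1)// lerDl ltW.
    by rewrite mulmxA -wk -expmxD addrA subrK.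
  have Nk : N (w k) (x (tau k.+1)) <= C * expR ((s + la) * tau k.+1).
    rewrite xr ?lexx ?andbT; last by rewrite (le_trans _ rk1)// lerDl ltW.
    exact: run_bound.
  exists (tau k.+1), (w k); split=> //.
  - by rewrite tau_ge0 lexx.
  - apply: le_trans (N_switch _ wk) _.
    rewrite (_ : s * _ + _ = m * s + (s + la) * tau k.+1); last by ring.
    by rewrite expRD mulrCA ler_wpM2l ?expR_ge0.
  - exact: x_flow.
exists (c * ((G * expR (`|s| * m) + 1) * C)) => t t0.
have [k tk] : exists k, tau k <= t <= tau k.+1.
  apply: contrapT => /forallNP noint.
  have tau_le_t k : tau k <= t.
    elim: k => [|k IH]; first by rewrite tau0.
    by rewrite leNgt; apply/negP => tk; apply: (noint k); rewrite IH ltW.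
  have tau_km k : k%:R * m <= tau k.
    elim: k => [|k IH]; first by rewrite mul0r.
    by apply: le_trans (tauS k); rewrite -natr1 mulrDl mul1r lerD2r.
  have := le_trans (tau_km (Num.truncn (t / m)).+1) (tau_le_t _).
  rewrite -ler_pdivlMr// leNgt => /negP; apply.
  by have /andP[] := truncn_itv (divr_ge0 t0 (ltW m_gt0)).
have [r [i [/andP[r0 rk] Nr Nrm xr]]] := runP k.
have rt : r <= t by case/andP: tk => kt _; exact: le_trans kt.
have -> : x t = expmx ((t - r) *: A (w k)) *m x r.
  by apply: xr; rewrite rt; case/andP: tk.
apply: le_trans (cP (w k) _) _; rewrite -!mulrA ler_wpM2l//.
rewrite mulrDl mul1r; have [rmt|rmt] := leP (r + m) t.
  apply: le_trans (run_bound C0 rmt Nrm) _.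
  by rewrite lerDr !mulr_ge0 ?expR_ge0.
apply: le_trans (run_start_bound (i := i) (G := G) C0 G0 _ _ Nr) _.
- by move=> y u; exact: GP.
- by rewrite rt ltW.
- by rewrite -!mulrA lerDl mulr_ge0 ?expR_ge0.
Qed.

End upper_bound.

(** * Gluing exponentials into a trajectory *)

Section trajectory_construction.
Variables (R : realType) (d n : nat) (A : 'I_n -> 'M[R]_d) (m : R).
Variables (w : nat -> 'I_n) (delta : nat -> R) (y : nat -> 'cV[R]_d).
Hypotheses (m_gt0 : 0 < m) (delta_ge : forall k, m <= delta k).
Hypothesis yS : forall k, y k.+1 = expmx (delta k *: A (w k)) *m y k.

Definition switching_time k := \sum_(i < k) delta i.
Local Notation tau := switching_time.

Lemma switching_timeS k : tau k.+1 = tau k + delta k.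
Proof. by rewrite /tau big_ord_recr. Qed.

Lemma switching_time_ge k : k%:R * m <= tau k.
Proof.
elim: k => [|k IH]; first by rewrite mul0r /tau big_ord0.
by rewrite switching_timeS -natr1 mulrDl mul1r lerD.
Qed.

Lemma switching_time_lt k : tau k < tau k.+1.
Proof. by rewrite switching_timeS ltrDl (lt_le_trans m_gt0). Qed.

Lemma switching_time_homo : {homo tau : i j / (i <= j)%N >-> i <= j}.
Proof.
apply: homo_leq => // [i j k|k]; first exact: le_trans.
exact/ltW/switching_time_lt.
Qed.

(** The time spent in the [k]th interval up to time [t]: [t - tau k] truncated
    to [[0, delta k]]. *)
Definition elapsed k (t : R) := Num.min (Num.max (t - tau k) 0) (delta k).

(** The first [k] intervals of the trajectory, frozen at its value at time
    [tau k] afterwards.  As a product of exponentials of continuous functions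
    of [t] it is continuous on the whole line, so that the glued trajectory
    needs no argument at the switching times. *)
Fixpoint frozen k (t : R) : 'cV[R]_d :=
  if k is k'.+1 then expmx (elapsed k' t *: A (w k')) *m frozen k' t else y 0%N.

Lemma frozen_before k t : t <= tau k -> frozen k.+1 t = frozen k t.
Proof.
move=> tk /=; rewrite /elapsed max_r ?subr_le0//.
rewrite min_l ?scale0r ?expmx0 ?mul1mx//.
exact: le_trans (ltW m_gt0) _.
Qed.

Lemma frozen_stable j k t : (j <= k)%N -> t <= tau j -> frozen k t = frozen j t.
Proof.
move=> jk tj; elim: k jk => [|k IH]; first by rewrite leqn0 => /eqP ->.
rewrite leq_eqVlt => /orP[/eqP ->//|jk].
by rewrite frozen_before ?IH// (le_trans tj)// switching_time_homo.
Qed.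

Lemma frozen_after k t : tau k <= t -> frozen k t = y k.
Proof.
elim: k => [//|k IH] tk /=.
rewrite IH ?yS; last by apply: le_trans tk; exact/ltW/switching_time_lt.
rewrite /elapsed min_r// le_max; apply/orP; left.
by rewrite lerBrDl -switching_timeS.
Qed.

Lemma frozen_during k t : tau k <= t <= tau k.+1 ->
  frozen k.+1 t = expmx ((t - tau k) *: A (w k)) *m y k.
Proof.
move=> /andP[kt tk] /=; rewrite frozen_after// /elapsed max_l ?subr_ge0//.
by rewrite min_l// lerBlDl -switching_timeS.
Qed.

Lemma continuous_frozen k : continuous (frozen k).
Proof.
elim: k => [|k IH] t; first exact: cvg_cst.
have celapsed : continuous (elapsed k).
  move=> u; apply: (@continuous_min _ _ (fun u => Num.max (u - tau k) 0)
    (cst (delta k))); last exact: cvg_cst.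
  apply: (@continuous_max _ _ (fun u => u - tau k) (cst 0)).
    2: exact: cvg_cst.
  by apply: cvgB => //; exact: cvg_cst.
have cE : continuous (fun u => expmx (elapsed k u *: A (w k))).
  move=> u; apply: (@continuous_comp _ _ _ (elapsed k)
    (fun s => expmx (s *: A (w k)))).
    exact: celapsed.
  exact: is_derive_continuous (is_derive_expmx _ _).
exact: continuous_mulmx.
Qed.

(** Any [k] with [t <= tau k] gives the same value [frozen k t]; this one works
    since [k m <= tau k]. *)
Definition glued t := frozen (Num.truncn (t / m)).+1 t.

Lemma lt_switching_time_truncn (t : R) : t < tau (Num.truncn (t / m)).+1.
Proof.
apply: lt_le_trans (switching_time_ge _).
by rewrite -ltr_pdivrMr// truncnS_gt.
Qed.

Lemma gluedE k t : t <= tau k -> glued t = frozen k t.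
Proof.
move=> tk; rewrite /glued; pose j := (Num.truncn (t / m)).+1; rewrite -/j.
have tj : t <= tau j by rewrite ltW//; exact: lt_switching_time_truncn.
have [kj|/ltnW jk] := leqP k j; first exact: frozen_stable.
exact/esym/frozen_stable.
Qed.

Lemma glued_switching_time k : glued (tau k) = y k.
Proof. by rewrite (gluedE (lexx _)) frozen_after. Qed.

Lemma glued_during k t : tau k <= t <= tau k.+1 ->
  glued t = expmx ((t - tau k) *: A (w k)) *m y k.
Proof.
by move=> /[dup] /andP[_ tk]; rewrite (gluedE tk); exact: frozen_during.
Qed.

Lemma continuous_glued : continuous glued.
Proof.
move=> t; pose k := (Num.truncn (t / m)).+1.
have tk : t < tau k by exact: lt_switching_time_truncn.
rewrite /continuous_at (gluedE (ltW tk)).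
have := @continuous_frozen k t; rewrite /continuous_at; apply: cvg_trans.
apply: near_eq_cvg; near=> s; apply/esym/gluedE/ltW.
by near: s; exact: lt_nbhsl.
Unshelve. all: by end_near. Qed.

Lemma switching_interval_inj j k t :
  tau j < t < tau j.+1 -> tau k < t < tau k.+1 -> j = k.
Proof.
move=> /andP[jt tj] /andP[kt tk].
have [jk|kj|//] := ltngtP j k.
- have := switching_time_homo jk; rewrite leNgt (lt_trans kt)//.
- have := switching_time_homo kj; rewrite leNgt (lt_trans jt)//.
Qed.

Lemma glued_trajectory : trajectory A m glued.
Proof.
have [L LP] : exists L : R -> 'M[R]_d, (forall t, exists j, L t = A j) /\
    (forall k t, tau k < t < tau k.+1 -> L t = A (w k)).
  have /choice[v vP] : forall t, exists j, forall k,
      tau k < t < tau k.+1 -> j = w k.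
    move=> t; have [[k tk]|no] := pselect (exists k, tau k < t < tau k.+1).
      by exists (w k) => k' tk'; rewrite (switching_interval_inj tk tk').
    by exists (w 0%N) => k tk; case: no; exists k.
  by exists (A \o v); split=> [t|k t tk]; [exists (v t)|rewrite /= (vP t k)].
case: LP => LA Lw; exists tau, L; split.
- split=> [|k|t _|k s t sk tk].
  + by rewrite /tau big_ord0.
  + by rewrite switching_timeS lerD2l.
  + exact: LA.
  + by rewrite (Lw k s)// (Lw k t).
- exact/continuous_subspaceT/continuous_glued.
- move=> k t tk; rewrite (Lw k)//.
  have /andP[kt tk1] := tk.
  have -> : glued t = expmx ((1 * t + - tau k) *: A (w k)) *m y k.
    by rewrite mul1r; apply: glued_during; rewrite !ltW.
  apply: (near_eq_is_derive (f := fun s : R =>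
    expmx ((1 * s + - tau k) *: A (w k)) *m y k)).
    near=> s; rewrite mul1r; apply/esym/glued_during; apply/andP; split.
      by apply: ltW; near: s; exact: lt_nbhsr.
    by apply: ltW; near: s; exact: lt_nbhsl.
  rewrite -[X in is_derive _ _ _ X]scale1r.
  exact: (is_derive_affine_comp (is_derive_expmxV _ _ _)).
Unshelve. all: by end_near. Qed.

End trajectory_construction.

(** * Paths of the discretization *)

(** Koenig's lemma for a tree of words over a finite alphabet: [P k v] depends
    only on the letters of [v] up to index [k], and [ext k v] says that the
    first [k] letters of [v] are the beginning of arbitrarily long words
    satisfying [P]. *)
Lemma koenig (T : finType) (P : nat -> (nat -> T) -> Prop) :
  (forall k v w, (forall l, (l <= k)%N -> v l = w l) -> P k v -> P k w) ->
  (forall k v, P k.+1 v -> P k v) ->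
  (forall k, exists v, P k v) -> exists v, forall k, P k v.
Proof.
move=> Ploc Pmono Pex.
have Ple k K v : (k <= K)%N -> P K v -> P k v.
  move=> kK; elim: K kK => [|K IH]; first by rewrite leqn0 => /eqP ->.
  by rewrite leq_eqVlt => /orP[/eqP ->//|kK /Pmono]; exact: IH.
pose ext k v := forall K, exists2 w, forall l, (l < k)%N -> w l = v l & P K w.
pose upd (v : nat -> T) k a := fun l => if l == k then a else v l.
have step k v : exists a, ext k v -> ext k.+1 (upd v k a).
  have [evk|nev] := pselect (ext k v); last first.
    by have [w _] := Pex 0%N; exists (w 0%N).
  apply: contrapT => /forallNP nostep.
  have /choice[K KP] : forall a, exists K, ~ exists2 w,
      forall l, (l < k.+1)%N -> w l = upd v k a l & P K w.
    move=> a; apply: contrapT => /forallNP noK; apply: (nostep a) => _ K.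
    by apply: contrapT; exact: noK.
  have [w wv Pw] := evk (\max_a K a)%N.
  apply: (KP (w k)); exists w; last by apply: Ple Pw; exact: leq_bigmax.
  move=> l; rewrite ltnS leq_eqVlt /upd => /orP[/eqP ->|lk].
    by rewrite eqxx.
  by rewrite ltn_eqF// wv.
have [F FP] : exists F : nat -> (nat -> T) -> T,
    forall k v, ext k v -> ext k.+1 (upd v k (F k v)).
  have /choice[F FP] : forall kv : nat * (nat -> T),
      exists a, ext kv.1 kv.2 -> ext kv.1.+1 (upd kv.2 kv.1 a).
    by move=> [k v]; exact: step.
  by exists (fun k v => F (k, v)) => k v; exact: (FP (k, v)).
have [v0 _] := Pex 0%N.
pose V := fix V k := if k is k'.+1 then upd (V k') k' (F k' (V k')) else v0.
have Vext k : ext k (V k).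
  elim: k => [|k IH]; last exact: FP.
  by move=> K; have [w Pw] := Pex K; exists w.
have Vstable l k : (l < k)%N -> V k l = V l.+1 l.
  elim: k => [//|k IH]; rewrite ltnS leq_eqVlt => /orP[/eqP ->//|lk].
  by rewrite -IH//= /upd ltn_eqF.
exists (fun l => V l.+1 l) => k.
have [w wV Pw] := Vext k.+1 k.
by apply: Ploc Pw => l lk; rewrite wV ?Vstable.
Qed.

Section discretization.
Variables (R : realType) (d n : nat) (A : 'I_n -> 'M[R]_d) (m h : R).
Hypotheses (m_gt0 : 0 < m) (h_gt0 : 0 < h).
Implicit Types v : nat -> 'I_n.

Fixpoint disc_op v k : 'M[R]_d :=
  if k is k'.+1 then edge_op A m h (v k) (v k') *m disc_op v k' else 1%:M.

Local Notation T := (disc_time m h).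

Lemma disc_trajectoryP v x :
  disc_trajectory A m h v x <-> forall k, x k = disc_op v k *m x 0%N.
Proof.
split=> [xS|xE] k; last by rewrite xE [in RHS]xE mulmxA.
by elim: k => [|k IH] /=; rewrite ?mul1mx// xS IH mulmxA.
Qed.

Lemma disc_opD v k l :
  disc_op v (k + l) = disc_op (fun s => v (k + s)%N) l *m disc_op v k.
Proof.
elim: l => [|l IH]; first by rewrite addn0 mul1mx.
by rewrite addnS /= IH mulmxA addnS.
Qed.

Lemma disc_time0 v : T v 0 = 0. Proof. by rewrite /disc_time big_ord0. Qed.

Lemma disc_timeS v k : T v k.+1 = T v k + edge_time m h (v k.+1) (v k).
Proof. by rewrite /disc_time big_ord_recr. Qed.

Lemma disc_timeD v k l : T v (k + l) = T v k + T (fun s => v (k + s)%N) l.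
Proof.
elim: l => [|l IH]; first by rewrite addn0 disc_time0 addr0.
by rewrite addnS !disc_timeS IH addrA addnS.
Qed.

Lemma edge_time_ge (j i : 'I_n) : Num.min m h <= edge_time m h j i.
Proof. by rewrite /edge_time; case: ifP; rewrite ge_min lexx ?orbT. Qed.

Lemma edge_time_le (j i : 'I_n) : edge_time m h j i <= Num.max m h.
Proof. by rewrite /edge_time; case: ifP; rewrite le_max lexx ?orbT. Qed.

Lemma disc_time_ge v k : k%:R * Num.min m h <= T v k.
Proof.
elim: k => [|k IH]; first by rewrite mul0r disc_time0.
by rewrite disc_timeS -natr1 mulrDl mul1r lerD// edge_time_ge.
Qed.

Lemma disc_time_le v k : T v k <= k%:R * Num.max m h.
Proof.
elim: k => [|k IH]; first by rewrite mul0r disc_time0.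
by rewrite disc_timeS -natr1 mulrDl mul1r lerD// edge_time_le.
Qed.

Lemma min_mh_gt0 : 0 < Num.min m h. Proof. by rewrite lt_min m_gt0. Qed.

Lemma disc_time_ge0 v k : 0 <= T v k.
Proof.
by apply: le_trans (disc_time_ge v k); rewrite mulr_ge0// ltW// min_mh_gt0.
Qed.

Lemma disc_op_local k v w :
  (forall l, (l <= k)%N -> v l = w l) -> disc_op v k = disc_op w k.
Proof.
elim: k => [//|k IH] vw /=; rewrite (vw k.+1)// (vw k)// IH// => l lk.
by apply: vw; rewrite leqW.
Qed.

Lemma disc_time_local k v w :
  (forall l, (l <= k)%N -> v l = w l) -> T v k = T w k.
Proof.
move=> vw; apply: eq_bigr => i _.
by rewrite !vw// ltnW.
Qed.

Lemma disc_op_block v j a b : (a <= b)%N ->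
  (forall l, (a < l <= b)%N -> v l = j) ->
  disc_op v b = expmx ((T v b - T v a) *: A j) *m disc_op v a.
Proof.
elim: b => [|b IH] ab vj.
  by move: ab; rewrite leqn0 => /eqP ->; rewrite subrr scale0r expmx0 mul1mx.
move: ab; rewrite leq_eqVlt => /orP[/eqP ->|ab].
  by rewrite subrr scale0r expmx0 mul1mx.
have vb : v b.+1 = j by apply: vj; rewrite ab leqnn.
rewrite disc_timeS addrAC [X in expmx (X *: _)]addrC expmxD -mulmxA.
rewrite -IH => [|//|l /andP[al lb]]; last by rewrite vj// al leqW.
by rewrite /= /edge_op vb.
Qed.

(** If the path is eventually constant, cut its tail into blocks of [p] steps,
    with [p] so large that they last at least [m]; otherwise cut it after each
    change of vertex, since a block then begins with an edge of duration [m].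
    In both cases the beginning of the path, whose first block may be too
    short, is dropped. *)
Lemma blocks_exist v : exists (kappa : nat -> nat) (w : nat -> 'I_n), forall k,
  [/\ (kappa k <= kappa k.+1)%N,
      forall l, (kappa k < l <= kappa k.+1)%N -> v l = w k
    & m <= T v (kappa k.+1) - T v (kappa k)].
Proof.
have [[K [j vj]]|nconst] :=
    pselect (exists K j, forall l, (K < l)%N -> v l = j).
  pose p := (Num.truncn (m / Num.min m h)).+1.
  exists (fun k => K + k * p)%N, (fun=> j) => k; split.
  - by rewrite leq_add2l mulSn leq_addl.
  - move=> l /andP[Kl _]; apply: vj; apply: leq_ltn_trans Kl.
    exact: leq_addr.
  - rewrite mulSn addnCA addnC disc_timeD addrC addKr.
    apply: le_trans (disc_time_ge _ _).
    by rewrite -ler_pdivrMr ?min_mh_gt0// ltW// truncnS_gt.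
have switch K : exists l, (K <= l)%N && (v l.+1 != v l).
  apply: contrapT => /forallNP noswitch; apply: nconst; exists K, (v K).
  move=> l; elim: l => [//|l IH]; rewrite ltnS => Kl.
  have := noswitch l; rewrite Kl/= => /negP; rewrite negbK => /eqP ->.
  by move: Kl; rewrite leq_eqVlt => /orP[/eqP ->//|]; exact: IH.
pose nx K := ex_minn (switch K).
pose kappa := fix kappa k := if k is k'.+1 then nx (kappa k').+1 else nx 0%N.
exists kappa, (fun k => v (kappa k).+1) => k.
have sw : v (kappa k).+1 != v (kappa k).
  by case: k => [|k] /=; rewrite /nx; case: ex_minnP => l /andP[].
have [kS mink] : (kappa k < kappa k.+1)%N /\
    forall l, (kappa k < l < kappa k.+1)%N -> v l.+1 = v l.
  rewrite /= /nx; case: ex_minnP => l /andP[kl _] lmin.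
  split=> // q /andP[kq ql].
  apply/eqP/negPn/negP => vq; have := lmin q; rewrite kq vq => /(_ isT).
  by rewrite leqNgt ql.
split; first exact: ltnW.
  elim=> [//|l IH] /andP[kl lk]; move: kl; rewrite ltnS leq_eqVlt.
  move=> /orP[/eqP ->//|kl].
  by rewrite mink ?kl// IH// kl ltnW.
rewrite -(subnKC kS) disc_timeD disc_timeS /edge_time (negbTE sw).
by rewrite -[X in X - _]addrA addrAC subrr add0r lerDl disc_time_ge0.
Qed.

End discretization.

(** * Paths growing at the rate of the joint spectral radius *)

Section joint_spectral_radius.
Variables (R : realType) (d n : nat) (d_gt0 : (0 < d)%N) (n_gt0 : (0 < n)%N).
Variables (A : 'I_n -> 'M[R]_d) (m h : R) (m_gt0 : 0 < m) (h_gt0 : 0 < h).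
Variables (N0 N : 'I_n -> 'cV[R]_d -> R).
Hypothesis N0_norm : multinorm N0.
Let rho := joint_spectral_radius A m h N0.
Hypothesis N_ext : extremal_multinorm A m h rho N.

Local Notation T := (disc_time m h).
Local Notation op := (disc_op A m h).

Let growth := fun k : nat => sup [set r : R | exists v x,
    [/\ disc_trajectory A m h v x, N0 (v 0%N) (x 0%N) = 1
      & r = N0 (v k) (x k) `^ (T v k)^-1]].

Let ones : 'cV[R]_d := const_mx 1.

Let ones_neq0 : ones != 0.
Proof.
apply/eqP => /matrixP/(_ (Ordinal d_gt0) 0); rewrite !mxE.
exact/eqP/oner_neq0.
Qed.

Lemma growth_ge0 k : 0 <= growth k.
Proof.
have [ub|nub] := pselect (has_ubound [set r : R | exists v x,
    [/\ disc_trajectory A m h v x, N0 (v 0%N) (x 0%N) = 1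
      & r = N0 (v k) (x k) `^ (T v k)^-1]]); last first.
  by rewrite /growth sup_out// => -[].
pose v : nat -> 'I_n := fun=> Ordinal n_gt0.
pose x0 := (N0 (v 0%N) ones)^-1 *: ones.
apply: (@le_trans _ _ (N0 (v k) (op v k *m x0) `^ (T v k)^-1)).
  exact: powR_ge0.
apply: (ub_le_sup ub); exists v, (fun k => op v k *m x0); split=> //.
  by apply/disc_trajectoryP => l; rewrite mul1mx.
have [_ fZ _] := N0_norm (v 0%N).
have N1 : 0 < N0 (v 0%N) ones by exact: is_norm_gt0.
by rewrite mul1mx fZ normfV gtr0_norm// mulVf// gt_eqF.
Qed.

(** The existence of an extremal multinorm excludes [rho = 0], as the operators
    of the edges are invertible.  Since 0 is also the default value of a limit
    that does not exist, the limit defining [rho] exists. *)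
Lemma joint_spectral_radius_gt0 : 0 < rho /\ growth @ \oo --> rho.
Proof.
have [N_norm Next] := N_ext.
have rho_neq0 : rho != 0.
  apply/eqP => rho0; pose j := Ordinal n_gt0.
  have := Next j j ones; rewrite rho0 powR0; last first.
    by rewrite /edge_time eqxx gt_eqF.
  rewrite mul0r leNgt is_norm_gt0//; apply/eqP => /(congr1 (mulmx
    (expmx (- edge_time m h j j *: A j)))).
  rewrite mulmx0 mulmxA -expmxD addNr scale0r expmx0 mul1mx.
  exact/eqP.
have cv : cvgn growth.
  by apply: contrapT => /dvgP; exact/eqP.
split=> //; rewrite lt_neqAle eq_sym rho_neq0/=.
by apply: limr_ge => //; apply: nearW; exact: growth_ge0.
Qed.

Let s := ln rho.

Lemma rho_powR t : rho `^ t = expR (s * t).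
Proof.
by rewrite expRM /s lnK// posrE; have [] := joint_spectral_radius_gt0.
Qed.

Lemma norm_edge_step v k x :
  N (v k.+1) (op v k.+1 *m x) <=
    expR (s * edge_time m h (v k.+1) (v k)) * N (v k) (op v k *m x).
Proof.
by have [_ Next] := N_ext; rewrite -rho_powR /= -mulmxA; exact: Next.
Qed.

Lemma norm_path_le v k l x : (k <= l)%N ->
  N (v l) (op v l *m x) <= expR (s * (T v l - T v k)) * N (v k) (op v k *m x).
Proof.
elim: l => [|l IH].
  by rewrite leqn0 => /eqP ->; rewrite subrr mulr0 expR0 mul1r.
rewrite leq_eqVlt => /orP[/eqP ->|kl]; first by rewrite subrr mulr0 expR0 mul1r.
apply: le_trans (norm_edge_step _ _ _) _.
have -> : T v l.+1 - T v k = edge_time m h (v l.+1) (v l) + (T v l - T v k).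
  by rewrite disc_timeS addrAC addrC.
rewrite mulrDr expRD -mulrA.
by rewrite ler_wpM2l ?expR_ge0//; exact: IH.
Qed.

Lemma contraction_iter k :
  (forall v x,
    N (v k) (op v k *m x) <= 2^-1 * expR (s * T v k) * N (v 0%N) x) ->
  forall j v x, N (v (j * k)%N) (op v (j * k) *m x) <=
    2^-1 ^+ j * expR (s * T v (j * k)%N) * N (v 0%N) x.
Proof.
move=> contr; elim=> [|j IH] v x.
  by rewrite mul0n disc_time0 mulr0 expR0 mul1mx expr0 !mul1r.
rewrite mulSn disc_opD disc_timeD -mulmxA mulrDr expRD exprSr.
apply: le_trans (IH (fun l => v (k + l)%N) _) _.
rewrite /= addn0.
rewrite [leRHS](_ : _ =
  2^-1 ^+ j * expR (s * T (fun l => v (k + l)%N) (j * k)) *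
  (2^-1 * expR (s * T v k) * N (v 0%N) x)); last by ring.
by rewrite ler_wpM2l ?contr// mulr_ge0 ?expR_ge0// exprn_ge0//.
Qed.

(** Otherwise the paths of length [j k] contract by [2 ^- j] relative to
    [rho ^ time]; as the time of such a path is at most [j k max(m, h)], for
    large [j] the [j k]th term of the sequence converging to [rho] is at most
    [exp (s - gap)], a bound below [rho] that does not depend on [j]. *)
Lemma noncontracting_path k : exists v x, x != 0 /\
  2^-1 * expR (s * T v k) * N (v 0%N) x <= N (v k) (op v k *m x).
Proof.
have [N_norm _] := N_ext.
have [rho0 grho] := joint_spectral_radius_gt0.
apply: contrapT => nopath.
have contr v x :
    N (v k) (op v k *m x) <= 2^-1 * expR (s * T v k) * N (v 0%N) x.
  have [->|x0] := eqVneq x 0.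
    by rewrite mulmx0 !is_norm0// mulr0.
  rewrite leNgt; apply/negP => lt; apply: nopath; exists v, x; split=> //.
  exact: ltW.
have k0 : (0 < k)%N.
  case: (posnP k) contr => // -> /(_ (fun=> Ordinal n_gt0) ones).
  rewrite disc_time0 mulr0 expR0 mulr1 mul1mx.
  have := is_norm_gt0 (N_norm (Ordinal n_gt0)) ones_neq0.
  by move=> /= N1; lra.
have citer := contraction_iter contr.
have [C1 C10 C1P] := multinorm_equivalent N0_norm N_norm.
have [C2 C20 C2P] := multinorm_equivalent N_norm N0_norm.
pose b := C1 * C2 + 1.
pose H := Num.max m h.
have H0 : 0 < H by rewrite lt_max m_gt0.
have b0 : 0 < b by rewrite ltr_wpDl// mulr_ge0.
have ln2 : 0 < ln 2 :> R by rewrite ln_gt0// ltr1n.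
have kR : 0 < k%:R :> R by rewrite ltr0n.
(* Half of the rate [ln 2 / (k H)]; the other half absorbs the constant [b] that
   compares the two multinorms. *)
pose gap := ln 2 / (2 * k%:R * H).
have gap0 : 0 < gap by rewrite divr_gt0// !mulr_gt0.
have growth_jk j : (0 < j)%N -> 2 * b / ln 2 <= j%:R ->
    growth (j * k)%N <= expR (s - gap).
  move=> j0 jbig; rewrite /growth; set S := (X in sup X).
  have [->|/set0P S0] := eqVneq S set0; first by rewrite sup0 expR_ge0.
  apply: (ge_sup S0) => _ [v [x [/disc_trajectoryP xE Nx0 ->]]].
  have T0 : 0 < T v (j * k)%N.
    apply: lt_le_trans (disc_time_ge _ _ _ _).
    by rewrite mulr_gt0 ?min_mh_gt0// ltr0n muln_gt0 j0.
  have Nbound : N0 (v (j * k)%N) (x (j * k)%N) <=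
      expR (ln b + j%:R * - ln 2 + s * T v (j * k)%N).
    rewrite !expRD lnK ?posrE// expRM_natl expRN lnK ?posrE// -mulrA xE.
    apply: le_trans (C1P _ (v (j * k)%N) _) _.
    apply: le_trans (ler_wpM2l C10 (citer _ _ _)) _.
    set g := _ * expR _; have g0 : 0 <= g by rewrite mulr_ge0 ?expR_ge0.
    have Nx : N (v 0%N) (x 0%N) <= C2.
      by apply: le_trans (C2P _ (v 0%N) _) _; rewrite Nx0 mulr1.
    apply: le_trans (ler_wpM2l C10 (ler_wpM2l g0 Nx)) _.
    by rewrite mulrCA [leLHS]mulrC ler_wpM2r// /b lerDl.
  apply: (@le_trans _ _ (expR (ln b + j%:R * - ln 2 + s * T v (j * k)%N) `^
      (T v (j * k)%N)^-1)).
    apply: ge0_ler_powR; rewrite ?nnegrE ?expR_ge0 ?is_norm_ge0//.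
    by rewrite invr_ge0 ltW.
  rewrite -expRM ler_expR ler_pdivrMr// mulrBl.
  have lnb := ln_sublinear b0.
  have bj : 2 * b <= j%:R * ln 2 by rewrite -ler_pdivrMr.
  have gapT : gap * T v (j * k)%N <= j%:R * ln 2 / 2.
    apply: le_trans (ler_wpM2l (ltW gap0) (disc_time_le _ _ _ _)) _.
    rewrite natrM -/H /gap le_eqVlt; apply/orP; left; apply/eqP.
    by field; rewrite !gt_eqF.
  lra.
have near_gt : \forall l \near \oo, expR (s - gap) < growth l.
  apply: (cvgr_gt _ grho).
  by rewrite -[ltRHS]lnK ?posrE// -/s ltr_expR ltrBlDr ltrDl.
have [M _ MP] := near_gt.
pose J := (M + (Num.truncn (2 * b / ln 2)).+1)%N.
have J0 : (0 < J)%N by rewrite /J addnS.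
have MJk : (M <= J * k)%N.
  by rewrite (leq_trans (leq_addr _ _) (leq_pmulr _ k0)).
have := MP (J * k)%N MJk; rewrite /= ltNge growth_jk//.
apply: (@le_trans _ _ (Num.truncn (2 * b / ln 2)).+1%:R).
  by rewrite ltW// truncnS_gt.
by rewrite ler_nat leq_addl.
Qed.

(** By linearity the end of a noncontracting path is large for some vector of
    the standard basis.  Extremality then bounds all its intermediate norms
    from below with the same constant, so that the paths that are good for a
    given basis vector form a tree. *)
Lemma growing_path : exists v (i : 'I_d), exists2 c, 0 < c &
  forall k, c * expR (s * T v k) <= N (v k) (op v k *m delta_mx i 0).
Proof.
have [N_norm _] := N_ext.
have [b b0 bP] := mx_norm_le_multinorm N_norm.
(* The initial vector is a combination of [d] basis vectors with coefficients at
   most [b] times its norm; [b + 1] is used because [b] may vanish. *)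
pose c := (2 * d%:R * (b + 1))^-1.
have dR : 0 < d%:R :> R by rewrite ltr0n.
have b1 : 0 < b + 1 by rewrite ltr_wpDl.
have c0 : 0 < c by rewrite invr_gt0 !mulr_gt0.
have end_large k : exists v i,
    c * expR (s * T v k) <= N (v k) (op v k *m delta_mx i 0).
  have [v [x [x0 Nx]]] := noncontracting_path k; exists v.
  apply: contrapT => /forallNP small.
  have {}small i : N (v k) (op v k *m delta_mx i 0) < c * expR (s * T v k).
    by rewrite ltNge; apply/negP; exact: small.
  have Nx0 : 0 < N (v 0%N) x by exact: is_norm_gt0.
  have e0 := expR_gt0 (s * T v k).
  have : N (v k) (op v k *m x) <=
      d%:R * (b * N (v 0%N) x * (c * expR (s * T v k))).
    rewrite {1}(matrix_sum_delta x) mulmx_sumr.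
    apply: le_trans (is_norm_sum (N_norm _) _) _.
    rewrite -[d in d%:R]card_ord mulr_natl -sumr_const; apply: ler_sum => i _.
    rewrite big_ord1 -scalemxAr; have [_ -> _] := N_norm (v k).
    apply: ler_pM; rewrite ?is_norm_ge0//; last exact: ltW.
    by apply: le_trans (bP _ _); exact: mx_norm_coord.
  move=> /(le_trans Nx); apply/negP; rewrite -ltNge.
  rewrite (_ : d%:R * _ = b / (b + 1) *
    (2^-1 * expR (s * T v k) * N (v 0%N) x)); last first.
    by rewrite /c; field; rewrite !gt_eqF.
  rewrite gtr_pMl ?mulr_gt0//.
  by rewrite ltr_pdivrMr// mul1r ltrDl.
have prefix_large i k v :
    c * expR (s * T v k) <= N (v k) (op v k *m delta_mx i 0) ->
    forall l, (l <= k)%N ->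
    c * expR (s * T v l) <= N (v l) (op v l *m delta_mx i 0).
  move=> large l lk; have := le_trans large (norm_path_le v (delta_mx i 0) lk).
  rewrite mulrBr expRB mulrAC ler_pdivlMr ?expR_gt0// => H.
  rewrite -(ler_pM2l (expR_gt0 (s * T v k))).
  by rewrite mulrA [_ * c]mulrC.
pose P i k v := forall l, (l <= k)%N ->
  c * expR (s * T v l) <= N (v l) (op v l *m delta_mx i 0).
have PS i k v : P i k.+1 v -> P i k v by move=> H l lk; apply: H; exact: leqW.
have Ple i k K v : (k <= K)%N -> P i K v -> P i k v.
  by move=> kK H l lk; apply: H; exact: leq_trans kK.
have [i iP] : exists i, forall k, exists v, P i k v.
  apply: contrapT => /forallNP noi.
  have /choice[K KP] : forall i, exists k, ~ exists v, P i k v.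
    by move=> i; apply: contrapT => /forallNP nok; apply: (noi i) => k;
      apply: contrapT; exact: nok.
  have [v [i vi]] := end_large (\max_i K i)%N.
  apply: (KP i); exists v; apply: (@Ple i _ (\max_i K i)%N).
    exact: leq_bigmax.
  exact: prefix_large.
have [|//|v vP] := @koenig _ (P i) _ (PS i).
  move=> k v w vw H l lk; have vwl q : (q <= l)%N -> v q = w q.
    by move=> ql; apply: vw; exact: leq_trans lk.
  rewrite -(disc_time_local m h vwl) -(disc_op_local A m h vwl) -vwl//.
  exact: H.
by exists v, i, c => // k; exact: (vP k k).
Qed.

(** The growing path, cut into blocks, is a trajectory [x] with
    [c' exp (s t) <= |x t| <= C exp (a t)], up to constant factors, at the
    switching times, which tend to infinity. *)
Lemma ln_joint_spectral_radius_le a :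
  (forall x, trajectory A m x ->
    exists C : R, forall t, 0 <= t -> `|x t| <= C * expR (a * t)) -> s <= a.
Proof.
move=> aP; have [N_norm _] := N_ext.
have [v [i [c c0 vP]]] := growing_path.
have [kappa [w kw]] := blocks_exist m_gt0 h_gt0 v.
pose delta k := T v (kappa k.+1) - T v (kappa k).
pose y k : 'cV[R]_d := op v (kappa k) *m delta_mx i 0.
have delta_ge k : m <= delta k by have [] := kw k.
have yS k : y k.+1 = expmx (delta k *: A (w k)) *m y k.
  by have [kS vw _] := kw k; rewrite /y (disc_op_block A m h kS vw) mulmxA.
have tauE k : switching_time delta k = T v (kappa k) - T v (kappa 0).
  by rewrite /switching_time -(big_mkord xpredT delta) telescope_sumr.
have [C CP] := aP _ (glued_trajectory m_gt0 delta_ge yS).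
have [b b0 bP] := multinorm_le_mx_norm N_norm.
rewrite leNgt; apply/negP => sa.
pose c' := c * expR (s * T v (kappa 0%N)).
have c'0 : 0 < c' by rewrite mulr_gt0// expR_gt0.
have bound k : c' * (1 + (s - a) * (k%:R * m)) <= b * C.
  have tau_ge := switching_time_ge delta_ge k.
  have tau0 : 0 <= switching_time delta k.
    by apply: le_trans tau_ge; rewrite mulr_ge0// ltW.
  have := CP _ tau0; rewrite (glued_switching_time m_gt0 delta_ge yS) => yC.
  have := le_trans (vP (kappa k)) (le_trans (bP _ _) (ler_wpM2l b0 yC)).
  have -> : T v (kappa k) = T v (kappa 0%N) + switching_time delta k.
    by rewrite tauE addrC subrK.
  rewrite mulrDr expRD => cC.
  have {}cC : c' * expR ((s - a) * switching_time delta k) <= b * C.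
    rewrite mulrBl expRB mulrA ler_pdivrMr ?expR_gt0//.
    by rewrite /c' -!mulrA.
  apply: le_trans cC; rewrite ler_wpM2l ?(ltW c'0)//.
  apply: le_trans (expR_ge1Dx _).
  by rewrite lerD2l ler_wpM2l// subr_ge0 ltW.
have sam : 0 < (s - a) * m by rewrite mulr_gt0// subr_gt0.
have := bound (Num.truncn (b * C / c' / ((s - a) * m))).+1.
rewrite mulrC -ler_pdivlMr// mulrCA => le1.
have := truncnS_gt (b * C / c' / ((s - a) * m)).
rewrite ltr_pdivrMr// => lt1.
have := lt_le_trans lt1 (le_trans _ le1).
by rewrite lerDr ler01 ltxx => /(_ isT).
Qed.

End joint_spectral_radius.

(** * The two-sided estimate of the Lyapunov exponent *)

Theorem theorem5 (R : realType) (d n : nat) (d_gt0 : (0 < d)%N)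
    (n_gt0 : (0 < n)%N) (A : 'I_n -> 'M[R]_d) (m : R) (m_gt0 : 0 < m)
    (A_irr : irreducible_family A) (h : R) (h_gt0 : 0 < h)
    (N0 : 'I_n -> 'cV[R]_d -> R) (N0_norm : multinorm N0)
    (N : 'I_n -> 'cV[R]_d -> R)
    (N_ext : extremal_multinorm A m h (joint_spectral_radius A m h N0) N) :
  let sigma_h := ln (joint_spectral_radius A m h N0) in
  let K := shifted_square_norm A sigma_h N in
  (sigma_h%:E <= lyapunov_exponent A m)%E /\
  (0 < 1 - K / 8 * h ^+ 2 ->
   (lyapunov_exponent A m <=
      (sigma_h - m^-1 * ln (1 - K / 8 * h ^+ 2))%:E)%E).
Proof.
move=> sigma_h K; split.
  apply: le_ereal_inf_tmp => _ [a aP <-]; rewrite lee_fin.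
  exact: (ln_joint_spectral_radius_le d_gt0 n_gt0 m_gt0 h_gt0 N0_norm N_ext).
move=> K_small; apply: ereal_inf_lbound.
exists (sigma_h - m^-1 * ln (1 - K / 8 * h ^+ 2)) => // x x_traj.
have [N_norm Next] := N_ext.
have powE := rho_powR d_gt0 n_gt0 h_gt0 N0_norm N_ext.
have K_ge0 : 0 <= K by exact: bigmax_ge_id.
rewrite -mulNr; apply: (@trajectory_bound _ _ _ A m h sigma_h K N) => //.
- move=> j z; have := Next j j z.
  by rewrite powE /edge_op /edge_time eqxx [_ * h]mulrC.
- move=> i j z ij; have := Next i j z.
  by rewrite powE /edge_op /edge_time eq_sym (negbTE ij) [_ * m]mulrC.
- move=> j z; apply: le_trans (le_op_norm (N_norm j) _ _) _.
  rewrite ler_wpM2r ?is_norm_ge0//.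
  exact: (le_bigmax _ (fun j => op_norm (N j) ((A j - sigma_h%:M) ^+ 2)) j).
Qed.
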